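(* Let $n\ge 3$, $2^*=\frac{2n}{n-2}$, and let $\Omega\subset\mathbb{R}^n$ be a smooth domain. Assume $\phi\in C^2(\Omega)$, $\phi>0$ in $\Omega$, and that for some constant $C>0$ the weighted $L^1$ inequality \[ \int_\Omega \phi^{\frac{2(n-1)}{n-2}}|\nabla v|\,dx\ \ge\ C\int_\Omega \phi^{\frac{n}{n-2}}|\nabla\phi|\,|v|\,dx \] holds for all $v\in C_0^\infty(\Omega)$. Then there exists $c>0$ such that \[ \int_\Omega|\nabla u|^2dx\ \ge\ -\int_\Omega\frac{\Delta\phi}{\phi}|u|^2dx+c\left(\int_\Omega|u|^{2^*}dx\right)^{2/2^*}\qquad\text{for all } u\in C_0^\infty(\Omega). \] *)

(* Defs.v *)
From HB Require Import structures.
From mathcomp Require Import all_boot all_order all_algebra.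
From mathcomp Require Import all_classical all_reals all_analysis.
Set Implicit Arguments. Unset Strict Implicit. Unset Printing Implicit Defensive.
Import Order.TTheory GRing.Theory Num.Theory.
Import numFieldNormedType.Exports.
Local Open Scope classical_set_scope.
Local Open Scope ring_scope.

Section Defs.
Variable R : realType.

Definition evec n (i : 'I_n) : 'rV[R]_n := delta_mx 0 i.

Definition pderiv n (i : 'I_n) (f : 'rV[R]_n -> R) : 'rV[R]_n -> R :=
  fun x => 'D_(evec i) f x.

Fixpoint pderivs n (s : seq 'I_n) (f : 'rV[R]_n -> R) : 'rV[R]_n -> R :=
  if s is i :: s' then pderiv i (pderivs s' f) else f.

Definition Ck_on n (k : nat) (A : set 'rV[R]_n) (f : 'rV[R]_n -> R) :=
  (forall s : seq 'I_n, (size s < k)%N ->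
     forall i x, A x -> derivable (pderivs s f) x (evec i)) /\
  (forall s : seq 'I_n, (size s <= k)%N ->
     forall x, A x -> {for x, continuous (pderivs s f)}).

Definition Cinf_on n (A : set 'rV[R]_n) (f : 'rV[R]_n -> R) :=
  forall k, Ck_on k A f.

Definition grad_norm n (f : 'rV[R]_n -> R) (x : 'rV[R]_n) : R :=
  Num.sqrt (\sum_(i < n) (pderiv i f x) ^+ 2).

Definition laplacian n (f : 'rV[R]_n -> R) (x : 'rV[R]_n) : R :=
  \sum_(i < n) pderiv i (pderiv i f) x.

(* smooth domain: nonempty open connected set whose boundary is locally a
   regular level set {g = 0} of a smooth g, with Omega = {g < 0} locally *)
Definition smooth_domain n (Omega : set 'rV[R]_n) :=
  [/\ open Omega, Omega !=set0, connected Omega &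
   forall p, closure Omega p -> ~ Omega p ->
     exists U : set 'rV[R]_n, exists g : 'rV[R]_n -> R,
       [/\ open U, U p, Cinf_on U g,
           (forall x, U x -> exists i, pderiv i g x != 0) &
           Omega `&` U = [set x | U x /\ g x < 0]]].

Definition Cinf_c n (Omega : set 'rV[R]_n) (v : 'rV[R]_n -> R) :=
  [/\ Cinf_on setT v,
      compact (closure [set x | v x != 0]) &
      closure [set x | v x != 0] `<=` Omega].

Definition vcons n (t : R) (y : 'rV[R]_n) : 'rV[R]_n.+1 :=
  \row_(i < n.+1) (if unlift ord0 i is Some j then y ord0 j else t).

(* Lebesgue integral over R^n, as iterated one-dimensional Lebesgue integrals
   (all integrands below are continuous with compact support, for which this
   coincides with the n-dimensional Lebesgue integral by Fubini). *)
Fixpoint integral_Rn n : ('rV[R]_n -> R) -> R :=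
  match n with
  | 0%N => fun f => f 0
  | m.+1 => fun f =>
      Rintegral (@lebesgue_measure R) setT
        (fun t => integral_Rn (fun y : 'rV[R]_m => f (vcons t y)))
  end.

Definition integral_on n (Omega : set 'rV[R]_n) (f : 'rV[R]_n -> R) : R :=
  integral_Rn (fun x => if `[< Omega x >] then f x else 0).

End Defs.

(* Main.v *)
(** Write [a = 2(n-1)/(n-2)], [p = 2n/(n-2)] and [Z = grad u - u (grad phi)/phi],
that is [phi] times the gradient of [u/phi].  Integrating the divergence of
[u^2 (grad phi)/phi] gives [int |grad u|^2 + int (lap phi/phi) u^2 = int |Z|^2],
so a Sobolev inequality for [Z] is wanted.  The Gagliardo-Nirenberg inequality
for [|u|^a] bounds [int |u|^p] by [int |u|^(a-1) |grad u|]; here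
[|grad u| <= |Z| + |u| |grad phi|/phi], and the contribution of the second term
is controlled by the first through the weighted hypothesis tested on
[|u|^a phi^(-a)], whose weighted gradient is [a |u|^(a-1) |Z|].  Cauchy-Schwarz
concludes.

The test function is only C^1, so the hypothesis has to be extended by a smooth
approximation: lattice sums [sum_k g(k/N) prod_i eta(N x_i - k_i)], where [eta]
is smooth and [eta' (y) = theta y - theta (y-1)] with [eta], [theta] two
nonnegative partitions of unity, converge in C^1.

Iterated integrals of continuous compactly supported functions are limits of
grid sums; Gagliardo-Nirenberg and the vanishing of integrals of derivatives
are proved on the grid, where the latter is a telescoping sum. *)

Require Import Defs.
From HB Require Import structures.
From mathcomp Require Import all_boot all_order all_algebra.
From mathcomp Require Import all_classical all_reals all_analysis.
From mathcomp Require Import ring lra.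
Set Implicit Arguments. Unset Strict Implicit. Unset Printing Implicit Defensive.
Import Order.TTheory GRing.Theory Num.Theory.
Import numFieldNormedType.Exports.
Local Open Scope classical_set_scope.
Local Open Scope ring_scope.

(** * Grid sums and the discrete Loomis-Whitney inequality *)

Section GridSums.
Variable R : realType.

(** Three identities tie the exponents together. [n a/(n-1) = p]: Gagliardo-Nirenberg for [|u|^a]
    produces [|u|^p]. [2(a-1) = p]: Cauchy-Schwarz splits [|u|^(a-1) |Z|] into [|u|^p] and [|Z|^2].
    [n/(n-2) - a = -1]: the test function turns the weight on the smaller side of the hypothesis
    into [|grad phi|/phi]. With [A = int |u|^p] and [E = int |Z|^2] this gives
    [A^(n-1) <= k^n (A E)^(n/2)], and cancelling powers of [A] leaves the remainder term. The
    obstacle is the integral: being iterated, it gives no direct access to a change of the order of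
    integration, on which Loomis-Whitney and the integration of a derivative in an inner variable
    depend. On a grid this is the exchange of finite sums. Mollifying by convolution would meet the
    same obstacle, whereas a finite lattice sum is differentiated term by term; the condition on
    [eta'] then lets summation by parts move the difference onto [g], so that continuity of its
    first derivatives is enough. *)

Definition upd n (x : 'rV[R]_n) (i : 'I_n) (t : R) : 'rV[R]_n :=
  \row_j (if j == i then t else x 0 j).

Lemma upd_id n (x : 'rV[R]_n) i : upd x i (x 0 i) = x.
Proof. by apply/rowP => j; rewrite mxE; case: eqP => [->|]. Qed.

Lemma upd_upd n (x : 'rV[R]_n) i s t : upd (upd x i s) i t = upd x i t.
Proof. by apply/rowP => j; rewrite !mxE; case: eqP. Qed.

Lemma updC n (x : 'rV[R]_n) i j s t : i != j ->
  upd (upd x i s) j t = upd (upd x j t) i s.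
Proof.
move=> ij; apply/rowP => k; rewrite !mxE.
by case: (eqVneq k j) => [->|//]; rewrite eq_sym (negbTE ij).
Qed.

Lemma updE n (x : 'rV[R]_n) i t : upd x i t 0 i = t.
Proof. by rewrite mxE eqxx. Qed.

Lemma updD n (x : 'rV[R]_n) i t h : upd x i t + h *: evec R i = upd x i (t + h).
Proof.
apply/rowP => j; rewrite !mxE eqxx/=.
by case: eqP => _; rewrite ?mulr1 ?mulr0 ?addr0.
Qed.

Lemma upd_vcons n (t s : R) (y : 'rV[R]_n) : upd (vcons s y) ord0 t = vcons t y.
Proof.
apply/rowP => j; rewrite !mxE.
by case: (unliftP ord0 j) => [k ->|->]; rewrite ?eqxx // eq_sym (negbTE (neq_lift _ _)).
Qed.

Lemma upd_vcons_lift n (t s : R) (y : 'rV[R]_n) j :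
  upd (vcons s y) (lift ord0 j) t = vcons s (upd y j t).
Proof.
apply/rowP => k; rewrite !mxE.
case: (unliftP ord0 k) => [l ->|->]; last by rewrite (negbTE (neq_lift _ _)).
by rewrite !mxE (inj_eq lift_inj).
Qed.

Variables L N : nat.

Definition node (k : nat) : R := k%:R / N%:R - L%:R.

(** The result is again a function on the whole space, constant in coordinate [i]. The operators for
    different coordinates therefore compose, and they commute by [gsumC], which plays the part of
    Fubini's theorem. *)
Definition gsum n (i : 'I_n) (f : 'rV[R]_n -> R) : 'rV[R]_n -> R :=
  fun x => N%:R^-1 * \sum_(k < (L.*2 * N)%N) f (upd x i (node k)).

Definition gsums n (s : seq 'I_n) (f : 'rV[R]_n -> R) := foldr (@gsum n) f s.

(** Once every coordinate is summed out the base point is immaterial. The corner is a grid point for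
    positive [L] and [N], so that [gsums_le] applies to it. *)
Definition rsum n (f : 'rV[R]_n -> R) : R := gsums (enum 'I_n) f (const_mx (- L%:R)).

(** Inequalities between grid sums are claimed at grid points only: the bound of [|f|] by a line sum
    telescopes from node to node and says nothing in between. *)
Definition ingrid n (x : 'rV[R]_n) :=
  forall i, exists2 k : nat, (k < L.*2 * N)%N & x 0 i = node k.

Lemma ingrid_upd n (x : 'rV[R]_n) i (k : 'I_(L.*2 * N)) :
  ingrid x -> ingrid (upd x i (node k)).
Proof.
move=> gx j; rewrite mxE; case: eqP => _; last exact: gx.
by exists k.
Qed.

Lemma node0 : node 0 = - L%:R. Proof. by rewrite /node mul0r sub0r. Qed.

Lemma ingrid_corner n : (0 < L)%N -> (0 < N)%N ->
  ingrid (const_mx (- L%:R) : 'rV[R]_n).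
Proof.
move=> L0 N0 i; rewrite mxE; exists 0%N; last by rewrite node0.
by rewrite muln_gt0 double_gt0 L0.
Qed.

Lemma gsumC n (i j : 'I_n) f : gsum i (gsum j f) = gsum j (gsum i f).
Proof.
have [->//|ij] := eqVneq i j.
apply/funext => x; rewrite /gsum; congr (_ * _).
rewrite -!mulr_sumr; congr (_ * _); rewrite exchange_big /=.
by apply: eq_bigr => k _; apply: eq_bigr => l _; rewrite updC.
Qed.

Lemma gsum_gsums n (i : 'I_n) s f : gsum i (gsums s f) = gsums s (gsum i f).
Proof. by elim: s => //= j s IH; rewrite gsumC IH. Qed.

Lemma gsumsD n s (f g : 'rV[R]_n -> R) :
  gsums s (fun x => f x + g x) = (fun x => gsums s f x + gsums s g x).
Proof.
elim: s => //= i s ->; apply/funext => x.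
by rewrite /gsum big_split mulrDr.
Qed.

Lemma gsumsZ n s a (f : 'rV[R]_n -> R) :
  gsums s (fun x => a * f x) = (fun x => a * gsums s f x).
Proof.
elim: s => //= i s ->; apply/funext => x.
by rewrite /gsum -mulr_sumr mulrCA.
Qed.

Lemma gsums_cst n (s : seq 'I_n) c : (0 < N)%N ->
  gsums s (fun=> c) = (fun=> (L.*2)%:R ^+ size s * c).
Proof.
move=> N0; elim: s => /= [|i s ->]; first by apply/funext => x; rewrite mul1r.
apply/funext => x; rewrite /gsum big_const_ord iter_addr_0 -[_ *+ (_ * _)%N]mulr_natl natrM.
rewrite exprS; field.
by rewrite pnatr_eq0 -lt0n.
Qed.

Lemma gsums_le n (s : seq 'I_n) f g : (forall x, ingrid x -> f x <= g x) ->
  forall x, ingrid x -> gsums s f x <= gsums s g x.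
Proof.
move=> fg; elim: s => //= i s IH x gx.
rewrite /gsum ler_wpM2l ?invr_ge0 ?ler0n// ler_sum// => k _.
by apply: IH; apply: ingrid_upd.
Qed.

Lemma gsums_ge0 n (s : seq 'I_n) f : (forall x, 0 <= f x) ->
  forall x, 0 <= gsums s f x.
Proof.
move=> f0; elim: s => //= i s IH x.
by rewrite mulr_ge0 ?invr_ge0 ?ler0n ?sumr_ge0.
Qed.

Lemma gsums_eq0 n (i : 'I_n) s f : i \in s -> (forall x, gsum i f x = 0) ->
  forall x, gsums s f x = 0.
Proof.
move=> is_ f0; suff H x : gsums s f x = 0 by [].
elim: s is_ x => //= j s IH; rewrite inE => /predU1P[<-|ls] x.
  rewrite gsum_gsums (_ : gsum i f = (fun=> 0)); last exact/funext.
  elim: s x {IH} => //= k s IH x; rewrite /gsum big1 ?mulr0// => l _; exact: IH.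
by rewrite /gsum big1 ?mulr0// => l _; apply: IH.
Qed.

Lemma gsums_filter n (i : 'I_n) s f : uniq s -> i \in s ->
  gsums [seq j <- s | j != i] (gsum i f) = gsums s f.
Proof.
elim: s => //= j s IH /andP[js us]; rewrite inE => /predU1P[->|is_].
  rewrite eqxx /= gsum_gsums; congr gsums; apply/all_filterP/allP => k ks.
  by apply: contraNneq js => <-.
by case: eqVneq => [ji|_] /=; [rewrite ji is_ in js|rewrite IH].
Qed.

Lemma gsum_upd n (i : 'I_n) f x t : gsum i f (upd x i t) = gsum i f x.
Proof.
by rewrite /gsum; congr (_ * _); apply: eq_bigr => k _; rewrite upd_upd.
Qed.

Lemma gsums_upd n (i : 'I_n) s f : i \notin s ->
  (forall x t, f (upd x i t) = f x) ->
  forall x t, gsums s f (upd x i t) = gsums s f x.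
Proof.
elim: s => //= j s IH; rewrite inE negb_or => /andP[ij is_] fi x t.
rewrite /gsum; congr (_ * _); apply: eq_bigr => k _.
by rewrite updC// IH.
Qed.

Lemma gsums_vcons n (s : seq 'I_n) f t y :
  gsums [seq lift ord0 i | i <- s] f (vcons t y) =
  gsums s (fun z => f (vcons t z)) y.
Proof.
elim: s y => //= i s IH y; rewrite /gsum; congr (_ * _).
by apply: eq_bigr => k _; rewrite upd_vcons_lift IH.
Qed.

Lemma rsum_recl n (f : 'rV[R]_n.+1 -> R) :
  rsum f = N%:R^-1 * \sum_(k < (L.*2 * N)%N) rsum (fun y => f (vcons (node k) y)).
Proof.
rewrite /rsum enum_ordSl /=; congr (_ * _); apply: eq_bigr => k _.
rewrite (_ : const_mx _ = vcons (- L%:R) (const_mx (- L%:R))) ?upd_vcons ?gsums_vcons//.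
by apply/rowP => j; rewrite !mxE; case: unlift => [l|//]; rewrite mxE.
Qed.

Lemma rsumD n (f g : 'rV[R]_n -> R) : rsum (fun x => f x + g x) = rsum f + rsum g.
Proof. by rewrite /rsum gsumsD. Qed.

Lemma rsumZ n a (f : 'rV[R]_n -> R) : rsum (fun x => a * f x) = a * rsum f.
Proof. by rewrite /rsum gsumsZ. Qed.

Definition dquot n (i : 'I_n) (f : 'rV[R]_n -> R) : 'rV[R]_n -> R :=
  fun x => N%:R * (f (x + N%:R^-1 *: evec R i) - f x).

Lemma nodeS k : node k + N%:R^-1 = node k.+1.
Proof. by rewrite /node -natr1; ring. Qed.

Lemma sum_dquot n (i : 'I_n) (f : 'rV[R]_n -> R) x m : (0 < N)%N ->
  N%:R^-1 * (\sum_(k < m) dquot i f (upd x i (node k))) =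
  f (upd x i (node m)) - f (upd x i (node 0)).
Proof.
move=> N0; rewrite /dquot -mulr_sumr mulrA mulVf ?mul1r ?pnatr_eq0 -?lt0n//.
under eq_bigr do rewrite updD nodeS.
by rewrite -(big_mkord predT (fun k => f (upd x i (node k.+1)) - f (upd x i (node k))))
  telescope_sumr.
Qed.

Lemma node_last : (0 < N)%N -> node (L.*2 * N) = L%:R.
Proof.
move=> N0; rewrite /node natrM mulfK ?pnatr_eq0 -?lt0n// -addnn natrD; ring.
Qed.

Lemma rsum_dquot n (i : 'I_n) (f : 'rV[R]_n -> R) : (0 < N)%N ->
  (forall x : 'rV[R]_n, L%:R <= `|x 0 i| -> f x = 0) -> rsum (dquot i f) = 0.
Proof.
move=> N0 f0; apply: (@gsums_eq0 _ i); first by rewrite mem_enum.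
move=> x; rewrite /gsum sum_dquot// !f0 ?subr0// updE.
  by rewrite node0 normrN normr_nat.
by rewrite node_last// normr_nat.
Qed.

(** The differences telescope from the edge of the box, where [f] vanishes, up to the node [x];
    extending the sum of absolute values to the whole line removes the dependence on coordinate
    [i]. *)
Lemma norm_le_gsum_dquot n (i : 'I_n) (f : 'rV[R]_n -> R) : (0 < N)%N ->
  (forall x : 'rV[R]_n, L%:R <= `|x 0 i| -> f x = 0) ->
  forall x, ingrid x -> `|f x| <= gsum i (fun y => `|dquot i f y|) x.
Proof.
move=> N0 f0 x gx; have [m mL xm] := gx i.
have fx : f x = N%:R^-1 * (\sum_(k < m) dquot i f (upd x i (node k))).
  rewrite sum_dquot// -xm upd_id [X in _ - X]f0 ?subr0//.
  by rewrite updE node0 normrN normr_nat.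
rewrite fx normrM ger0_norm ?invr_ge0 ?ler0n// ler_wpM2l ?invr_ge0 ?ler0n//.
apply: le_trans (ler_norm_sum _ _ _) _.
rewrite -(big_mkord predT (fun k => `|dquot i f (upd x i (node k))|)).
rewrite -(big_mkord predT (fun k => `|dquot i f (upd x i (node k))|)).
by rewrite [leRHS](big_cat_nat (leq0n m) (ltnW mL))/= lerDl sumr_ge0.
Qed.

End GridSums.

(** * Hoelder for finite sums, Loomis-Whitney and the Sobolev inequality on the grid *)

Section Hoelder.
Variable R : realType.

Lemma powR_root_AGM (I : finType) (P : pred I) (b : I -> R) :
  (0 < #|P|)%N -> (forall i, 0 <= b i) ->
  (\prod_(i in P) b i) `^ #|P|%:R^-1 <= (\sum_(i in P) b i) / #|P|%:R.
Proof.
move=> P0 b0.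
have := leif_AGM (fun i (_ : i \in P) => b0 i); case=> + _.
set a := _ / _ => H.
have a0 : 0 <= a by rewrite divr_ge0 ?ler0n ?sumr_ge0.
have -> : a = (a ^+ #|P|) `^ #|P|%:R^-1.
  by rewrite -powR_mulrn// -powRrM mulfV ?powRr1// pnatr_eq0 -lt0n.
by rewrite ge0_ler_powR ?invr_ge0 ?ler0n ?nnegrE ?exprn_ge0 ?prodr_ge0.
Qed.

(** If some factor has sum zero, every term on the left vanishes. Otherwise each factor is
    normalised to have sum one, the inequality between geometric and arithmetic means is applied for
    each [k], and the arithmetic means add up to one. *)
Lemma hoelder_prod (I : finType) (P : pred I) M (b : 'I_M -> I -> R) :
  (0 < #|P|)%N -> (forall k i, 0 <= b k i) ->
  \sum_k (\prod_(i in P) b k i) `^ #|P|%:R^-1 <=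
  (\prod_(i in P) \sum_k b k i) `^ #|P|%:R^-1.
Proof.
move=> P0 b0; set p := _^-1.
have p0 : p != 0 by rewrite invr_eq0 pnatr_eq0 -lt0n.
have B0 i : 0 <= \sum_k b k i by rewrite sumr_ge0.
have [[i Pi Bi]|allB] := pselect (exists2 i, i \in P & \sum_k b k i = 0).
  rewrite big1 ?powR_ge0// => k _.
  rewrite (bigD1 i)//= (_ : b k i = 0) ?mul0r ?powR0//.
  by have /psumr_eq0P := Bi; apply.
have Bgt i : i \in P -> 0 < \sum_k b k i.
  by move=> Pi; rewrite lt0r B0 andbT; apply/eqP => Bi; apply: allB; exists i.
set B := \prod_(i in P) _.
have Bpos : 0 < B by rewrite prodr_gt0.
have -> : \sum_k (\prod_(i in P) b k i) `^ p =
    B `^ p * \sum_k (\prod_(i in P) (b k i / \sum_k b k i)) `^ p.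
  rewrite mulr_sumr; apply: eq_bigr => k _.
  rewrite -powRM ?(ltW Bpos)//; last first.
    by rewrite prodr_ge0// => i _; rewrite divr_ge0.
  congr (_ `^ _); rewrite prodf_div mulrC divfK// gt_eqF//.
rewrite -[leRHS]mulr1 ler_wpM2l ?powR_ge0//.
apply: le_trans (_ : \sum_k (\sum_(i in P) (b k i / \sum_k b k i)) * p <= _).
  apply: ler_sum => k _; apply: powR_root_AGM => // i.
  by rewrite divr_ge0.
rewrite -mulr_suml exchange_big /=.
rewrite (eq_bigr (fun=> 1)); last first.
  by move=> i Pi; rewrite -mulr_suml mulfV// gt_eqF ?Bgt.
by rewrite sumr_const mulfV// pnatr_eq0 -lt0n.
Qed.

(* The coordinates are summed out one at a time; summing over coordinate [j]
   leaves the factor [a j] inert, and Hoelder with equal exponents is applied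
   to the remaining factors. *)
Lemma discrete_loomis_whitney (L N n : nat) (a : 'I_n -> 'rV[R]_n -> R) :
  (1 < n)%N ->
  (forall i x, 0 <= a i x) -> (forall i x t, a i (upd x i t) = a i x) ->
  forall s, uniq s -> forall x, ingrid L N x ->
  gsums L N s (fun x => (\prod_i a i x) `^ (n%:R - 1)^-1) x <=
  (\prod_i gsums L N [seq j <- s | j != i] (a i) x) `^ (n%:R - 1)^-1.
Proof.
move=> n1 a0 ai; elim => [//|j s IH] /= /andP[js us] x gx.
set p := (_ - 1)^-1.
have Pn : #|predC1 j| = n.-1 by rewrite cardC1 card_ord.
have n10 : (0 < n.-1)%N by rewrite -ltnS (prednK (ltnW n1)).
have pE : p = #|predC1 j|%:R^-1.
  by rewrite Pn /p -{1}(prednK (ltnW n1)) -natr1 addrK.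
pose c i := gsums L N [seq k <- s | k != i] (a i).
have c0 i y : 0 <= c i y by apply: gsums_ge0.
have cj t : c j (upd x j t) = c j x.
  by apply: gsums_upd => //; rewrite mem_filter eqxx.
apply: le_trans (_ : gsum L N j (fun x => (\prod_i c i x) `^ p) x <= _).
  rewrite /gsum ler_wpM2l ?invr_ge0 ?ler0n// ler_sum// => k _.
  by apply: IH => //; apply: ingrid_upd.
rewrite (bigD1 j)//= eqxx /=.
rewrite (_ : gsums L N _ (a j) x = c j x)//.
rewrite /gsum powRM ?c0//; last first.
  by rewrite prodr_ge0// => i _; apply: gsums_ge0.
rewrite (eq_bigr (fun k : 'I_(L.*2 * N) => c j x `^ p *
    (\prod_(i in predC1 j) c i (upd x j (node R L N k))) `^ p)); last first.
  move=> k _; rewrite (bigD1 j)//= cj powRM//; last first.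
    by rewrite prodr_ge0.
rewrite -mulr_sumr mulrCA ler_wpM2l ?powR_ge0//.
apply: le_trans (_ : N%:R^-1 * (\prod_(i in predC1 j)
    \sum_(k < (L.*2 * N)%N) c i (upd x j (node R L N k))) `^ p <= _).
  rewrite ler_wpM2l ?invr_ge0 ?ler0n// pE.
  by apply: hoelder_prod => //; rewrite Pn.
have [->|N0] := posnP N; first by rewrite invr0 mul0r powR_ge0.
(* The mesh factor is split into [n-1] equal factors under the root, one for each remaining [i], so
   that each inner sum becomes a [gsum]. *)
have -> : N%:R^-1 = (\prod_(i in predC1 j) N%:R^-1) `^ p :> R.
  rewrite prodr_const -powR_mulrn ?invr_ge0 ?ler0n// -powRrM pE mulfV ?powRr1//.
  by rewrite Pn pnatr_eq0 -lt0n.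
rewrite -powRM; last 2 first.
- by rewrite prodr_ge0// => i _; rewrite invr_ge0 ler0n.
- by rewrite prodr_ge0// => i _; rewrite sumr_ge0.
rewrite -big_split /= le_eqVlt; apply/orP; left; apply/eqP; congr (_ `^ _).
apply: eq_bigr => i ij; have ji : j != i by rewrite eq_sym; exact: ij.
by rewrite ji.
Qed.

(** [|f|] is bounded by each of its [n] line sums, hence [|f|^n] by their product; the [i]-th line
    sum does not depend on coordinate [i], as Loomis-Whitney requires. Raising to the power [n-1]
    keeps roots out of the statement, so that both sides pass to the limit. *)
Lemma discrete_sobolev (L N n : nat) (f : 'rV[R]_n -> R) :
  (1 < n)%N -> (0 < L)%N -> (0 < N)%N ->
  (forall (x : 'rV[R]_n) i, L%:R <= `|x 0 i| -> f x = 0) ->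
  rsum L N (fun x => `|f x| `^ (n%:R / (n%:R - 1))) ^+ n.-1 <=
  \prod_i rsum L N (fun y => `|dquot N i f y|).
Proof.
move=> n1 L0 N0 f0.
pose a i := gsum L N i (fun y => `|dquot N i f y|).
have a0 i x : 0 <= a i x by apply: (@gsums_ge0 R L N n [:: i]).
have n1R : n.-1%:R = n%:R - 1 :> R by rewrite -{2}(prednK (ltnW n1)) -natr1 addrK.
have n1N : n.-1%:R != 0 :> R.
  by rewrite pnatr_eq0 -lt0n -ltnS (prednK (ltnW n1)).
have := @discrete_loomis_whitney L N n a n1 a0.
have ai i x t : a i (upd x i t) = a i x by exact: gsum_upd.
move=> /(_ ai _ (enum_uniq 'I_n) _ (ingrid_corner _ L0 N0)).
rewrite (eq_bigr (fun i => rsum L N (fun y => `|dquot N i f y|))); last first.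
  by move=> i _; rewrite gsums_filter ?enum_uniq ?mem_enum.
set P := \prod_i _ => H.
have P0 : 0 <= P by rewrite prodr_ge0// => i _; apply: gsums_ge0.
have -> : P = (P `^ (n%:R - 1)^-1) ^+ n.-1.
  by rewrite -powR_mulrn ?powR_ge0// -powRrM -n1R mulVf// powRr1.
rewrite lerXn2r ?nnegrE ?powR_ge0 ?gsums_ge0//.
apply: (le_trans _ H); apply: gsums_le; last exact: ingrid_corner.
move=> x gx /=.
rewrite powRrM ge0_ler_powR ?nnegrE ?powR_ge0 ?prodr_ge0//.
  by rewrite -n1R invr_ge0 ler0n.
rewrite powR_mulrn// -[X in _ ^+ X]card_ord -prodr_const ler_prod// => i _.
by rewrite normr_ge0 /= norm_le_gsum_dquot// => y; exact: f0.
Qed.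

End Hoelder.

(** * The iterated integral as a limit of grid sums *)

Section OneDim.
Variable R : realType.
Local Notation mu := (@lebesgue_measure R).

Lemma itv_integrable (g : R -> R) (a b : R) : continuous g ->
  mu.-integrable `[a, b] (EFin \o g).
Proof.
move=> cg; apply: (@continuous_compact_integrable R g).
  exact: segment_compact.
by apply: continuous_subspaceT => x; exact: cg.
Qed.

Lemma le_norm_Rintegral_itv (g : R -> R) (a b e : R) : continuous g -> a <= b ->
  (forall t, a <= t <= b -> `|g t| <= e) ->
  `|\int[mu]_(t in `]a, b]) g t| <= e * (b - a).
Proof.
move=> cg ab ge.
have ig : mu.-integrable `]a, b] (EFin \o g).
  apply: integrableS (itv_integrable a b cg) => //=.
  exact: subset_itv_oc_cc.
apply: le_trans (le_normr_Rintegral _ ig) _ => //=.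
have ie : mu.-integrable `]a, b] (EFin \o (fun=> e)).
  apply: integrableS (@itv_integrable (fun=> e) a b _) => //=.
    exact: subset_itv_oc_cc.
  by move=> x; exact: cvg_cst.
apply: le_trans (_ : \int[mu]_(t in `]a, b]) e <= _).
  apply: le_Rintegral => //=.
    have := integrable_norm ig; rewrite /comp/=.
    exact.
  by move=> t /=; rewrite in_itv/= => /andP[/ltW at_ tb]; rewrite ge// at_.
rewrite Rintegral_cst//= lebesgue_measure_itv/= lte_fin.
by case: ltgtP ab => //= -> _; rewrite subrr !mulr0.
Qed.

Lemma Rintegral_cell (g : R -> R) (a b e : R) : continuous g -> a <= b ->
  (forall t, a <= t <= b -> `|g t - g a| <= e) ->
  `|\int[mu]_(t in `]a, b]) g t - (b - a) * g a| <= e * (b - a).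
Proof.
move=> cg ab ge.
have cga : continuous (fun t => g t - g a).
  by move=> x; apply: cvgB; [exact: cg|exact: cvg_cst].
have := le_norm_Rintegral_itv cga ab ge.
have ig (h : R -> R) : continuous h -> mu.-integrable `]a, b] (EFin \o h).
  move=> ch; apply: integrableS (itv_integrable a b ch) => //=.
  exact: subset_itv_oc_cc.
rewrite RintegralB//; last 2 first.
- exact: ig.
- by apply: ig => x; exact: cvg_cst.
rewrite Rintegral_cst//= lebesgue_measure_itv/= lte_fin.
rewrite (_ : fine _ = b - a) 1?mulrC//.
by case: ltgtP ab => //= -> _; rewrite subrr.
Qed.

Variable L : nat.

Lemma Rintegral_support (g : R -> R) :
  (forall t, L%:R <= `|t| -> g t = 0) ->
  \int[mu]_t g t = \int[mu]_(t in `]- L%:R, L%:R]) g t.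
Proof.
move=> g0; rewrite [RHS]Rintegral_mkcond; apply: eq_Rintegral => t _.
rewrite patchE; case: ifPn => //; rewrite notin_setE/= in_itv/= => /negP tL.
by apply: g0; rewrite leNgt ltr_norml; apply: contra tL => /andP[-> /ltW].
Qed.

Lemma Rintegral_close (g1 g2 : R -> R) (e : R) : continuous g1 -> continuous g2 ->
  (forall t, L%:R <= `|t| -> g1 t = 0) -> (forall t, L%:R <= `|t| -> g2 t = 0) ->
  (forall t, `|g1 t - g2 t| <= e) ->
  `|\int[mu]_t g1 t - \int[mu]_t g2 t| <= e * (L.*2)%:R.
Proof.
move=> c1 c2 s1 s2 H; rewrite !Rintegral_support//.
have ig (h : R -> R) : continuous h -> mu.-integrable `]- L%:R, L%:R] (EFin \o h).
  move=> ch; apply: integrableS (itv_integrable (- L%:R) L%:R ch) => //=.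
  exact: subset_itv_oc_cc.
rewrite -RintegralB//; [|exact: ig|exact: ig].
have -> : (L.*2)%:R = L%:R - - L%:R :> R by rewrite -addnn natrD opprK.
apply: le_norm_Rintegral_itv => //.
  by move=> x; apply: cvgB; [exact: c1|exact: c2].
by rewrite (@le_trans _ _ 0)// oppr_le0.
Qed.

Lemma Rintegral_riemann (N : nat) (g : R -> R) (e : R) : (0 < N)%N -> continuous g ->
  (forall t, L%:R <= `|t| -> g t = 0) ->
  (forall s t, `|s - t| <= N%:R^-1 -> `|g s - g t| <= e) ->
  `|\int[mu]_t g t - N%:R^-1 * \sum_(k < (L.*2 * N)%N) g (node R L N k)|
  <= e * (L.*2)%:R.
Proof.
move=> N0 cg g0 ge; rewrite Rintegral_support//.
have N0R : N%:R != 0 :> R by rewrite pnatr_eq0 -lt0n.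
have Ni0 : 0 <= N%:R^-1 :> R by rewrite invr_ge0 ler0n.
have step k : node R L N k.+1 - node R L N k = N%:R^-1.
  by rewrite -nodeS addrAC subrr add0r.
have le_node k : node R L N 0 <= node R L N k.
  by rewrite node0 /node lerDr mulr_ge0.
suff H m : `|\int[mu]_(t in `]node R L N 0, node R L N m]) g t -
    N%:R^-1 * \sum_(k < m) g (node R L N k)| <= e * (m%:R / N%:R).
  have := H (L.*2 * N)%N; rewrite node0 node_last// natrM mulfK//.
elim: m => [|m IH].
  by rewrite set_itv_ge ?bnd_simp ?ltxx// Rintegral_set0 big_ord0 !mulr0 subrr normr0 mul0r mulr0.
rewrite big_ord_recr /=.
have -> : \int[mu]_(t in `]node R L N 0, node R L N m.+1]) g t =
    \int[mu]_(t in `]node R L N 0, node R L N m]) g t +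
    \int[mu]_(t in `]node R L N m, node R L N m.+1]) g t.
  rewrite -(@Rintegral_itvB _ g (BRight (node R L N 0)) (BRight (node R L N m.+1)) (node R L N m)).
  - by rewrite addrC subrK.
  - apply: integrableS (itv_integrable (node R L N 0) (node R L N m.+1) cg) => //=.
    exact: subset_itv_oc_cc.
  - by rewrite bnd_simp.
  - by rewrite bnd_simp -nodeS lerDl.
have -> : e * (m.+1%:R / N%:R) = e * (m%:R / N%:R) + e * (node R L N m.+1 - node R L N m).
  by rewrite step -natr1 mulrDl mul1r mulrDr.
rewrite mulrDr opprD addrACA (le_trans (ler_normD _ _))// lerD//.
rewrite -(step m) Rintegral_cell//; first by rewrite -nodeS lerDl.
move=> t /andP[t1 t2]; apply: ge; rewrite ger0_norm ?subr_ge0//.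
by rewrite lerBlDl nodeS.
Qed.

End OneDim.

(** * Iterated integrals in several variables: error bounds for grid sums *)

Section MultiDim.
Variable R : realType.

Definition cont_supp n (L : nat) (f : 'rV[R]_n -> R) :=
  continuous f /\ (forall (x : 'rV[R]_n) i, L%:R <= `|x 0 i| -> f x = 0).

Lemma cont_supp_unif n L (f : 'rV[R]_n -> R) : cont_supp L f ->
  forall e, 0 < e -> exists2 d, 0 < d &
    forall x y : 'rV[R]_n, (forall i, `|x 0 i - y 0 i| <= d) -> `|f x - f y| <= e.
Proof.
move=> [cf f0] e e0.
pose K := [set x : 'rV[R]_n | forall i, x ord0 i \in `[(- L%:R), L%:R]%R].
have cK : compact K.
  apply: (@rV_compact R n (fun=> `[(- L%:R), L%:R]%classic)) => _; exact: segment_compact.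
have := (compact_near_coveringP K).1 cK R (0^'+)
  (fun d x => forall y, ball x d y -> `|f x - f y| <= e).
case.
- move=> x Kx; have e2 : 0 < e / 2 by rewrite divr_gt0.
  have /cvgrPdist_lt/(_ _ e2)/nbhs_ballP[r /= r0 rx] := cf x.
  exists (ball x (r / 2), [set d | 0 < d < r / 2]) => /=.
    split; first by apply: nbhsx_ballx; rewrite divr_gt0.
    near=> d; apply/andP; split; near: d; first exact: nbhs_right_gt.
    by apply: nbhs_right_lt; rewrite divr_gt0.
  move=> [y d] /= [xy /andP[d0 dr]] z yz.
  have fy : `|f x - f y| < e / 2.
    by apply: rx; apply: le_ball xy; rewrite ler_pdivrMr// ler_peMr ?(ltW r0)// ler1n.
  have fz : `|f x - f z| < e / 2.
    apply: rx; rewrite [r]splitr; apply: ball_triangle xy _.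
    by apply: le_ball yz; exact: ltW.
  rewrite (_ : f y - f z = (f x - f z) - (f x - f y)); last by ring.
  by rewrite (le_trans (ler_normB _ _))// [e]splitr lerD// ltW.
(* Covering gives the property for all small positive radii below [d], so it is used at [d / 2]; the
   second halving turns the non-strict coordinate bounds into membership in an open ball. *)
move=> d /= d0 dP; exists (d / 2 / 2); first by rewrite !divr_gt0.
have H (x y : 'rV[R]_n) : K x -> (forall i, `|x 0 i - y 0 i| <= d / 2 / 2) -> `|f x - f y| <= e.
  move=> Kx xy; have /= := dP (d / 2).
  rewrite sub0r normrN gtr0_norm ?divr_gt0//.
  apply => //.
  - by rewrite ltr_pdivrMr// ltr_pMr// ltr1n.
  - split; first by rewrite divr_gt0.
    move=> i j; rewrite (ord1 i) /ball/= (le_lt_trans (xy j))//.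
    by rewrite ltr_pdivrMr ?ltr_pMr ?divr_gt0// ltr1n.
have nK x : ~ K x -> f x = 0.
  move=> /existsNP[i]; rewrite in_itv/= => /negP xi; apply: (f0 _ i).
  by rewrite leNgt ltr_norml; apply: contra xi => /andP[/ltW-> /ltW].
move=> x y xy.
have [Kx|/nK fx] := pselect (K x); first exact: H.
have [Ky|/nK fy] := pselect (K y).
  by rewrite distrC; apply: H => // i; rewrite distrC.
by rewrite fx fy subrr normr0 ltW.
Unshelve. all: by end_near. Qed.

Lemma vcons0 n t (y : 'rV[R]_n) : vcons t y 0 ord0 = t.
Proof. by rewrite mxE; case: unliftP => // j /eqP; rewrite (negbTE (neq_lift _ _)). Qed.

Lemma vcons_lift n t (y : 'rV[R]_n) j : vcons t y 0 (lift ord0 j) = y 0 j.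
Proof. by rewrite mxE liftK. Qed.

Lemma vcons_dist n (s t d : R) (y z : 'rV[R]_n) : `|s - t| <= d ->
  (forall i, `|y 0 i - z 0 i| <= d) ->
  forall i, `|vcons s y 0 i - vcons t z 0 i| <= d.
Proof.
by move=> st yz i; case: (unliftP ord0 i) => [j|] ->; rewrite ?vcons0 ?vcons_lift.
Qed.

Lemma continuous_rV n (f : 'rV[R]_n -> R) :
  (forall (x : 'rV[R]_n) e, 0 < e -> exists2 d, 0 < d &
    forall y : 'rV[R]_n, (forall i, `|x 0 i - y 0 i| <= d) -> `|f x - f y| <= e) ->
  continuous f.
Proof.
move=> H x; apply/(@cvgrPdist_le _ _ _ (nbhs x)) => e e0.
have [d d0 dP] := H x e e0.
apply/nbhs_ballP; exists d => //= y [_ xy]; apply: dP => i.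
by apply: ltW; exact: xy.
Qed.

Lemma cont_supp_vcons n L (f : 'rV[R]_n.+1 -> R) t :
  cont_supp L f -> cont_supp L (fun y => f (vcons t y)).
Proof.
move=> Cf; split=> [|y i yi]; last by apply: (Cf.2 _ (lift ord0 i)); rewrite vcons_lift.
apply: continuous_rV => x e e0; have [d d0 dP] := cont_supp_unif Cf e0.
exists d => // y xy; apply: dP; apply: vcons_dist => //.
by rewrite subrr normr0 ltW.
Qed.

Lemma integral_Rn0 n : integral_Rn (fun _ : 'rV[R]_n => 0) = 0.
Proof.
elim: n => //= n IH; rewrite (_ : (fun _ => _) = fun=> 0); last exact/funext.
by rewrite Rintegral_cst// mul0r.
Qed.

(** Named because two facts depend on each other across dimensions: continuity of the slice integral
    in dimension [n+1] needs this bound in dimension [n], and the bound in dimension [n+1] needs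
    that continuity. *)
Definition Rn_close n L := forall (f1 f2 : 'rV[R]_n -> R) e,
  cont_supp L f1 -> cont_supp L f2 -> (forall x, `|f1 x - f2 x| <= e) ->
  `|integral_Rn f1 - integral_Rn f2| <= e * (L.*2)%:R ^+ n.

Lemma cont_supp_slice n L (f : 'rV[R]_n.+1 -> R) : Rn_close n L -> cont_supp L f ->
  continuous (fun t => integral_Rn (fun y => f (vcons t y))).
Proof.
move=> close Cf t; apply/cvgrPdist_le => eps eps0.
have c0 : 0 < (L.*2)%:R ^+ n + 1 :> R.
  by rewrite ltr_wpDl// exprn_ge0.
have [d d0 dP] := cont_supp_unif Cf (divr_gt0 eps0 c0).
apply/nbhs_ballP; exists d => //= s ts.
apply: (@le_trans _ _ (eps / ((L.*2)%:R ^+ n + 1) * (L.*2)%:R ^+ n)).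
  apply: close; [exact: cont_supp_vcons|exact: cont_supp_vcons|].
  move=> y; apply: dP; apply: vcons_dist; first exact: ltW.
  by move=> i; rewrite subrr normr0 ltW.
rewrite mulrAC ler_pdivrMr// ler_wpM2l ?(ltW eps0)//.
by rewrite lerDl.
Qed.

Lemma slice_support n L (f : 'rV[R]_n.+1 -> R) t : cont_supp L f ->
  L%:R <= `|t| -> integral_Rn (fun y => f (vcons t y)) = 0.
Proof.
move=> Cf tL; rewrite -(integral_Rn0 n); congr integral_Rn; apply/funext => y.
by apply: (Cf.2 _ ord0); rewrite vcons0.
Qed.

Lemma integral_Rn_close n L : Rn_close n L.
Proof.
elim: n => [|n IH] f1 f2 e C1 C2 H /=; first by rewrite mulr1.
rewrite exprSr mulrA; apply: Rintegral_close => [||t|t|t].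
- exact: cont_supp_slice C1.
- exact: cont_supp_slice C2.
- exact: slice_support.
- exact: slice_support.
- by apply: IH => //; exact: cont_supp_vcons.
Qed.

(** The outer integral is replaced by a one-dimensional Riemann sum of slice integrals, then each
    slice by its own grid sum. Every coordinate contributes one error [e] times the volume of the
    box, whence the factor [n]. *)
Lemma integral_Rn_riemann n L N (f : 'rV[R]_n -> R) e :
  (0 < L)%N -> (0 < N)%N -> cont_supp L f ->
  (forall x y : 'rV[R]_n, (forall i, `|x 0 i - y 0 i| <= N%:R^-1) -> `|f x - f y| <= e) ->
  `|integral_Rn f - rsum L N f| <= n%:R * e * (L.*2)%:R ^+ n.
Proof.
move=> L0 N0; elim: n f e => [|n IH] f e Cf H.
  rewrite /rsum (size0nil (size_enum_ord 0)) /= (_ : 0 = const_mx (- L%:R)) ?subrr ?normr0 ?mul0r//.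
  by apply/rowP => -[].
have Ni0 : 0 <= N%:R^-1 :> R by rewrite invr_ge0 ler0n.
rewrite rsum_recl /=; set g := fun t => integral_Rn _.
have gL t : L%:R <= `|t| -> g t = 0.
  exact: slice_support.
have cg : continuous g by exact: cont_supp_slice (@integral_Rn_close n L) Cf.
have ge s t : `|s - t| <= N%:R^-1 -> `|g s - g t| <= e * (L.*2)%:R ^+ n.
  move=> st; apply: integral_Rn_close; [exact: cont_supp_vcons|exact: cont_supp_vcons|].
  move=> y; apply: H; apply: vcons_dist => // i; by rewrite subrr normr0.
have := Rintegral_riemann N0 cg gL ge; set S := _ * _ => H1.
set T := _ * _.
have H2 : `|S - T| <= n%:R * e * (L.*2)%:R ^+ n * (L.*2)%:R.
  rewrite -mulrBr -sumrB normrM ger0_norm//.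
  apply: le_trans (_ : N%:R^-1 * \sum_(k < (L.*2 * N)%N) (n%:R * e * (L.*2)%:R ^+ n) <= _).
    rewrite ler_wpM2l// (le_trans (ler_norm_sum _ _ _))// ler_sum// => k _.
    apply: IH; first exact: cont_supp_vcons.
    by move=> x y xy; apply: H; apply: vcons_dist => //; rewrite subrr normr0.
  rewrite sumr_const card_ord -[_ *+ (_ * _)%N]mulr_natl natrM le_eqVlt; apply/orP; left.
  by apply/eqP; field; rewrite pnatr_eq0 -lt0n.
rewrite (_ : _ - T = (integral_Rn f - S) + (S - T)); last by rewrite /= addrA subrK.
apply: le_trans (ler_normD _ _) _; apply: le_trans (lerD H1 H2) _.
by rewrite le_eqVlt; apply/orP; left; apply/eqP; rewrite -natr1 exprSr; ring.
Qed.

Lemma near_invn (d : R) : 0 < d -> \forall N \near \oo, N%:R^-1 <= d.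
Proof.
move=> d0; near=> N.
have dN : d^-1 <= N%:R by near: N; exact: nbhs_infty_ger.
by rewrite invf_ple ?posrE// (lt_le_trans _ dN)// invr_gt0.
Unshelve. all: by end_near. Qed.

Lemma cvg_rsum n L (f : 'rV[R]_n -> R) : (0 < L)%N -> cont_supp L f ->
  rsum L N f @[N --> \oo] --> integral_Rn f.
Proof.
move=> L0 Cf; apply/cvgrPdist_le => e e0.
have c0 : 0 < n%:R * (L.*2)%:R ^+ n + 1 :> R by rewrite ltr_wpDl ?mulr_ge0 ?exprn_ge0.
have [d d0 dP] := cont_supp_unif Cf (divr_gt0 e0 c0).
near=> N.
have N0 : (0 < N)%N by near: N; exact: nbhs_infty_gt.
apply: le_trans (integral_Rn_riemann (e := e / (n%:R * (L.*2)%:R ^+ n + 1)) L0 N0 Cf _) _.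
  move=> x y xy; apply: dP => i; apply: le_trans (xy i) _.
  by near: N; exact: near_invn.
rewrite mulrAC mulrCA -[leRHS]mulr1 ler_wpM2l ?(ltW e0)//.
by rewrite ler_pdivrMr// mul1r lerDl.
Unshelve. all: by end_near. Qed.

(** * Linearity and monotonicity *)

Lemma cont_suppD n L (f g : 'rV[R]_n -> R) : cont_supp L f -> cont_supp L g ->
  cont_supp L (fun x => f x + g x).
Proof.
move=> [cf f0] [cg g0]; split=> [x|x i xi]; last by rewrite (f0 _ i)// (g0 _ i)// addr0.
by apply: continuousD; [exact: cf|exact: cg].
Qed.

Lemma cont_suppM n L (f g : 'rV[R]_n -> R) : cont_supp L f -> continuous g ->
  cont_supp L (fun x => g x * f x).
Proof.
move=> [cf f0] cg; split=> [x|x i xi]; last by rewrite (f0 _ i)// mulr0.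
by apply: continuousM; [exact: cg|exact: cf].
Qed.

Lemma cont_suppZ n L (f : 'rV[R]_n -> R) a : cont_supp L f ->
  cont_supp L (fun x => a * f x).
Proof. by move=> Cf; apply: cont_suppM => // x; exact: cst_continuous. Qed.

(** Linearity and monotonicity are inherited from the grid sums through the limit, so the inner
    integrals need no separate treatment. *)
Lemma integral_RnD n L (f g : 'rV[R]_n -> R) : (0 < L)%N ->
  cont_supp L f -> cont_supp L g ->
  integral_Rn (fun x => f x + g x) = integral_Rn f + integral_Rn g.
Proof.
move=> L0 Cf Cg; have H := cvg_rsum L0 (cont_suppD Cf Cg).
have K : rsum L N (fun x => f x + g x) @[N --> \oo] --> integral_Rn f + integral_Rn g.
  under eq_fun do rewrite rsumD.
  by apply: cvgD; exact: cvg_rsum.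
by rewrite -(cvg_lim (@Rhausdorff R) K) -(cvg_lim (@Rhausdorff R) H).
Qed.

Lemma integral_RnZ n L (f : 'rV[R]_n -> R) a : (0 < L)%N ->
  cont_supp L f -> integral_Rn (fun x => a * f x) = a * integral_Rn f.
Proof.
move=> L0 Cf; have H := cvg_rsum L0 (cont_suppZ a Cf).
have K : rsum L N (fun x => a * f x) @[N --> \oo] --> a * integral_Rn f.
  under eq_fun do rewrite rsumZ.
  by apply: cvgM; [exact: cvg_cst|exact: cvg_rsum].
by rewrite -(cvg_lim (@Rhausdorff R) K) -(cvg_lim (@Rhausdorff R) H).
Qed.

Lemma le_integral_Rn n L (f g : 'rV[R]_n -> R) : (0 < L)%N ->
  cont_supp L f -> cont_supp L g -> (forall x, f x <= g x) ->
  integral_Rn f <= integral_Rn g.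
Proof.
move=> L0 Cf Cg fg; apply: (ler_cvg_to (cvg_rsum L0 Cf) (cvg_rsum L0 Cg)).
near=> N; apply: gsums_le => //; apply: ingrid_corner => //.
by near: N; exact: nbhs_infty_gt.
Unshelve. all: by end_near. Qed.

Lemma integral_Rn_sum n L (I : Type) (s : seq I) (f : I -> 'rV[R]_n -> R) :
  (0 < L)%N -> (forall i, cont_supp L (f i)) ->
  cont_supp L (fun x => \sum_(i <- s) f i x) /\
  integral_Rn (fun x => \sum_(i <- s) f i x) = \sum_(i <- s) integral_Rn (f i).
Proof.
move=> L0 Cf; elim: s => [|i s [C IH]].
  have E : (fun x => \sum_(i <- [::]) f i x) = fun=> 0.
    by apply/funext => x; rewrite big_nil.
  rewrite E big_nil integral_Rn0; split=> //.
  by split=> // x; exact: cst_continuous.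
have E : (fun x => \sum_(j <- i :: s) f j x) = (fun x => f i x + \sum_(j <- s) f j x).
  by apply/funext => x; rewrite big_cons.
by rewrite E big_cons -IH; split; [exact: cont_suppD|exact: (integral_RnD L0)].
Qed.

End MultiDim.

(** * A smooth compactly supported partition of unity on the line *)

Section Bump.
Variable R : realType.

Lemma is_derive_cvg (V : normedModType R) (f : V -> R) x v df :
  h^-1 *: (f (h *: v + x) - f x) @[h --> (0:R)^'] --> df -> is_derive x v f df.
Proof.
move=> H; split; first by apply/cvg_ex; exists df.
exact: cvg_lim H.
Qed.

(** A directional derivative is a derivative along a line; through this equivalence [der_comp] uses
    the one-variable chain rule. *)
Lemma is_derive_line (V : normedModType R) (f : V -> R) x v df :
  is_derive (0 : R) 1 (fun t => f (t *: v + x)) df <-> is_derive x v f df.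
Proof.
have E : (fun h : R => h^-1 *: (f ((h *: (1 : R) + 0) *: v + x) - f (0 *: v + x))) =
    (fun h => h^-1 *: (f (h *: v + x) - f x)).
  by apply/funext => h; rewrite scale0r add0r addr0 [h *: 1]mulr1.
split=> -[H1 H2].
- apply: is_derive_cvg; rewrite -E -H2; exact: H1.
- by apply: is_derive_cvg; rewrite /= E -H2; exact: H1.
Qed.

Section Rules.
Variables (V : normedModType R) (x v : V).
Implicit Types f g : V -> R.

Lemma der_eq f df df' : is_derive x v f df -> df = df' -> is_derive x v f df'.
Proof. by move=> H <-. Qed.

Lemma derD f g df dg : is_derive x v f df -> is_derive x v g dg ->
  is_derive x v (fun y => f y + g y) (df + dg).
Proof. by move=> df' dg'; exact: is_deriveD. Qed.

Lemma derB f g df dg : is_derive x v f df -> is_derive x v g dg ->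
  is_derive x v (fun y => f y - g y) (df - dg).
Proof. by move=> df' dg'; exact: is_deriveB. Qed.

Lemma derM f g df dg : is_derive x v f df -> is_derive x v g dg ->
  is_derive x v (fun y => f y * g y) (df * g x + f x * dg).
Proof.
move=> df' dg'; apply: der_eq (is_deriveM df' dg') _.
by rewrite addrC /GRing.scale/= mulrC.
Qed.

Lemma derZ f df a : is_derive x v f df -> is_derive x v (fun y => a * f y) (a * df).
Proof. by move=> df'; exact: (is_deriveZ a df'). Qed.

Lemma derV f df : f x != 0 -> is_derive x v f df ->
  is_derive x v (fun y => (f y)^-1) (- df / f x ^+ 2).
Proof.
move=> f0 df'; split; first by apply: derivableV.
by rewrite deriveV// derive_val /GRing.scale/= mulrC mulrN mulNr.
Qed.

Lemma der_comp (h : R -> R) f dh df : is_derive (f x) 1 h dh ->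
  is_derive x v f df -> is_derive x v (fun y => h (f y)) (dh * df).
Proof.
move=> Hh /is_derive_line Hf; apply/is_derive_line.
apply: (@is_derive1_comp R h (fun t => f (t *: v + x))) => //.
by rewrite scale0r add0r.
Qed.

Lemma der_sum (I : Type) (s : seq I) (h : I -> V -> R) (dh : I -> R) :
  (forall i, is_derive x v (h i) (dh i)) ->
  is_derive x v (fun y => \sum_(i <- s) h i y) (\sum_(i <- s) dh i).
Proof.
move=> H; elim: s => [|i s IH].
  rewrite big_nil (_ : (fun _ => _) = cst 0); first exact: is_derive_cst.
  by apply/funext => y; rewrite big_nil.
rewrite big_cons (_ : (fun _ => _) = (fun y => h i y + \sum_(i <- s) h i y)).
  exact: derD.
by apply/funext => y; rewrite big_cons.
Qed.

End Rules.

(** Serves the points where the rules of calculus do not apply: outside the open unit interval,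
    endpoints included, for the bump, and the origin for [|t|^p]. *)
Lemma is_derive_quadratic (f : R -> R) x0 K :
  (\forall x \near x0, `|f x - f x0| <= K * (x - x0) ^+ 2) ->
  is_derive x0 1 f 0.
Proof.
move=> H; apply: is_derive_cvg; apply/cvgrPdist_le => e e0.
have K0 : 0 < `|K| + 1 by rewrite ltr_wpDl.
have [r /= r0 rP] := (nbhs_ballP _ _).1 H.
near=> h.
have h0 : h != 0 by near: h; exact: nbhs_dnbhs_neq.
rewrite sub0r normrN /= normrM normfV ler_pdivrMl ?normr_gt0//.
have hr : `|h| < Num.min r (e / (`|K| + 1)).
  near: h; apply: dnbhs0_lt; by rewrite lt_min r0 divr_gt0.
move: hr; rewrite lt_min => /andP[hr he].
have -> : h *: 1 + x0 = h + x0 by rewrite [h *: 1]mulr1.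
have hx : ball x0 r (h + x0).
  by rewrite -ball_normE /ball_/= opprD addrCA subrr addr0 normrN.
have /= /le_trans := rP _ hx; apply.
rewrite addrK (le_trans (ler_norm _))// normrM normrX expr2 mulrCA ler_wpM2l//.
rewrite -[leRHS](divfK (lt0r_neq0 K0)) mulrC ler_pM// ?(ltW he)//.
by rewrite lerDl.
Unshelve. all: by end_near. Qed.

Lemma mvt1 (F f : R -> R) (a b : R) : a < b -> (forall y : R, is_derive y 1 F (f y)) ->
  exists2 c, a < c < b & F b - F a = f c * (b - a).
Proof.
move=> ab dF; have [|c] := @MVT _ F f a b ab (fun x _ => dF x).
  apply: continuous_subspaceT => x; apply: differentiable_continuous.
  by apply/derivable1_diffP; exact: ex_derive.
by rewrite in_itv; exists c.
Qed.

Lemma is_derive_ge0_homo (F f : R -> R) : (forall y : R, is_derive y 1 F (f y)) ->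
  (forall y, 0 <= f y) -> {homo F : x y / x <= y}.
Proof.
move=> dF f0 x y; rewrite le_eqVlt => /predU1P[->//|xy].
have [c _ E] := mvt1 xy dF.
by rewrite -subr_ge0 E mulr_ge0// subr_ge0 ltW.
Qed.

Lemma antiderivative (f : R -> R) : continuous f -> (forall y : R, y <= 0 -> f y = 0) ->
  exists2 F : R -> R, (forall y : R, y <= 0 -> F y = 0) & forall y : R, is_derive y 1 F (f y).
Proof.
(* Integrating from [-1] rather than [0] puts every [y >= 0] strictly inside the interval of
   integration, as the fundamental theorem requires. *)
move=> cf f0; pose F (y : R) := \int[@lebesgue_measure R]_(t in `[-1, y]) f t.
have F0 y : y <= 0 -> F y = 0.
  move=> y0; rewrite /F (@eq_Rintegral _ _ _ _ _ (fun=> 0)); first by rewrite Rintegral_cst// mul0r.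
  by move=> t; rewrite inE/= in_itv/= => /andP[_ ty]; rewrite f0// (le_trans ty).
exists F => // y; have [y0|y0] := ltP y 0.
  rewrite f0 ?(ltW y0)//; apply: (@near_eq_is_derive _ _ _ (fun=> 0)).
    by near=> z; rewrite F0//; apply: ltW; near: z; exact: lt_nbhsl.
have yy : y < y + 1 by rewrite ltrDl.
have y1 : -1 < y by rewrite (lt_le_trans _ y0)// ltrN10.
have fi : lebesgue_measure.-integrable `[-1, y + 1] (EFin \o f).
  apply: (@continuous_compact_integrable R f); first exact: segment_compact.
  by apply: continuous_subspaceT => x; exact: cf.
have [dF F'] := continuous_FTC1_closed yy fi y1 (cf y).
by split; [exact: dF|rewrite -derive1E].
Unshelve. all: by end_near. Qed.

Let q (y : R) := y * (1 - y).

(** The classical bump [exp(-1/q)], with [q = y(1-y)], times a polynomial and a power of [1/q]. This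
    family is closed under differentiation, so a single derivative computation yields smoothness of
    every order. *)
Definition bumpfun (P : {poly R}) (m : nat) (y : R) : R :=
  if 0 < y < 1 then P.[y] * (q y)^-1 ^+ m * expR (- (q y)^-1) else 0.

(** The exponential series gives [r^(m+2) exp(-r) <= (m+2)!] with [r = 1/q], so the function is at
    most a constant times [q^2]. Since [y0] lies outside the open unit interval, [q y <= |y - y0|].
    The quadratic bound makes the derivative vanish at [y0]. *)
Lemma bumpfun_bound P m : exists K, forall y0 y, ~~ (0 < y0 < 1) ->
  `|bumpfun P m y - bumpfun P m y0| <= K * (y - y0) ^+ 2.
Proof.
pose C := \sum_(i < size P) `|P`_i|.
have C0 : 0 <= C by rewrite sumr_ge0.
exists (C * (m.+2)`!%:R) => y0 y y0N.
rewrite [X in _ - X]/bumpfun (negbTE y0N) subr0 /bumpfun.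
case: ifPn => [/andP[y1 y2]|_]; last by rewrite normr0 mulr_ge0 ?sqr_ge0// mulr_ge0.
have q0 : 0 < q y by rewrite mulr_gt0// subr_gt0.
have qy : q y <= `|y - y0|.
  move: y0N; rewrite negb_and -!leNgt => /orP[y0N|y0N].
    rewrite ger0_norm; last by rewrite subr_ge0 (le_trans y0N)// ltW.
    by rewrite (@le_trans _ _ y)//; [rewrite /q ler_piMr ?(ltW y1)// lerBlDr lerDl ltW|rewrite lerBrDr gerDl].
  rewrite ler0_norm; last by rewrite subr_le0 (le_trans _ y0N)// ltW.
  rewrite opprB (@le_trans _ _ (1 - y))//; last by rewrite lerB.
  by rewrite /q ler_piMl ?(ltW y2)// subr_ge0 ltW.
have PC : `|P.[y]| <= C.
  rewrite horner_coef (le_trans (ler_norm_sum _ _ _))// ler_sum// => i _.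
  rewrite normrM ler_piMr// normrX exprn_ile1// ger0_norm ?(ltW y1)//.
  exact: ltW.
set r := (q y)^-1; have r0 : 0 < r by rewrite invr_gt0.
have E : r ^+ m.+2 * expR (- r) <= (m.+2)`!%:R.
  rewrite expRN ler_pdivrMr ?expR_gt0// mulrC -ler_pdivrMr ?ltr0n ?fact_gt0//.
  by rewrite (le_trans _ (expR_ge1Dxn m.+1 (ltW r0)))// lerDr.
have -> : P.[y] * r ^+ m * expR (- r) = P.[y] * ((r ^+ m.+2 * expR (- r)) * q y ^+ 2).
  have <- : r ^+ m.+2 * q y ^+ 2 = r ^+ m; last by ring.
  by rewrite -addn2 exprD -mulrA -exprMn mulVf ?gt_eqF// expr1n mulr1.
rewrite normrM -[leRHS]mulrA ler_pM// normrM ler_pM//.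
  by rewrite ger0_norm// mulr_ge0 ?expR_ge0// exprn_ge0// ltW.
rewrite ger0_norm ?sqr_ge0// -[leRHS]real_normK ?num_real//.
by rewrite lerXn2r// ?nnegrE// ltW.
Qed.

(** Numerator of the derivative over [q^(m+2)]: the terms come from differentiating [P], [q^(-m)]
    and [exp(-1/q)], with [q' = 1 - 2y]. *)
Definition bump_step (P : {poly R}) (m : nat) : {poly R} :=
  P^`() * ('X * (1 - 'X)) ^+ 2 - m%:R *: (P * (1 - 'X *+ 2) * ('X * (1 - 'X)))
  + P * (1 - 'X *+ 2).

Lemma is_derive_bumpfun P m (y : R) :
  is_derive y 1 (bumpfun P m) (bumpfun (bump_step P m) m.+2 y).
Proof.
have [y01|yN] := boolP (0 < y < 1); last first.
  rewrite [X in is_derive _ _ _ X]/bumpfun (negbTE yN).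
  have [K HK] := bumpfun_bound P m.
  by apply: (is_derive_quadratic (K := K)); near=> x; exact: HK.
have [y0 y1] := andP y01.
have q0 : q y != 0 by rewrite gt_eqF// mulr_gt0// subr_gt0.
apply: (@near_eq_is_derive _ _ _ (fun y => P.[y] * (q y)^-1 ^+ m * expR (- (q y)^-1))).
  near=> z; rewrite /bumpfun (_ : 0 < z < 1)//.
  by apply/andP; split; near: z; [exact: lt_nbhsr|exact: lt_nbhsl].
have dq : is_derive y 1 q (1 - y *+ 2).
  have d1 : is_derive y 1 (fun y : R => 1 - y) (- 1) 
    by have := derB (@is_derive_cst R R R 1 y 1) (is_derive_id y 1); rewrite sub0r.
  by have H := derM (is_derive_id y 1) d1; apply: der_eq H _; ring.
have dr := derV q0 dq.
have rm m' : is_derive ((q y)^-1) 1 (fun z : R => z ^+ m') (m'%:R * (q y)^-1 ^+ m'.-1).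
  by split; [exact: exprn_derivable|rewrite exp_derive /GRing.scale/= mulr1].
have dm := @der_comp _ _ _ _ (fun z => (q z)^-1) _ _ (rm m) dr.
have dNr : is_derive y 1 (fun z => - (q z)^-1) (- (- (1 - y *+ 2) / q y ^+ 2)).
  exact: is_deriveN.
have de := @der_comp _ _ _ _ (fun z => - (q z)^-1) _ _ (is_derive_expR (- (q y)^-1)) dNr.
have dP : is_derive y 1 (horner P) P^`().[y] by exact: is_derive_poly.
have H := derM (derM dP dm) de; apply: der_eq H _.
have hs : (bump_step P m).[y] = P^`().[y] * q y ^+ 2
    - m%:R * (P.[y] * (1 - y *+ 2) * q y) + P.[y] * (1 - y *+ 2).
  by rewrite /bump_step /q !hornerE; ring.
rewrite /bumpfun y01 hs; move: (q y) q0 (expR _) => Q Q0 E {hs de dNr dm rm dr dq}.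
case: m => [|m] /=; first by rewrite !expr0 !exprS expr0; field.
by rewrite !exprS; move: (Q^-1 ^+ m) => A; field.
Unshelve. all: by end_near. Qed.

Lemma continuous_der (F f : R -> R) : (forall y : R, is_derive y 1 F (f y)) ->
  continuous F.
Proof.
move=> dF x; apply: differentiable_continuous.
by apply/derivable1_diffP; exact: ex_derive.
Qed.

(** For such [D] the function [D y - D (y - 1)] is nonnegative and of compact support, and the sum
    of its integer translates telescopes to one. *)
Definition is_step (D : R -> R) :=
  [/\ {homo D : x y / x <= y}, forall y, y <= -1 -> D y = 0 & forall y, 1 <= y -> D y = 1].

(** [s] is the normalised integral of the bump, a smooth step rising on [[0, 1]], and [B] is an
    integral of [s]. The partition is the smoothed hat [B (y+1) - 2 B y + B (y-1)], and [eta k] is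
    its [k]-th derivative. Its first derivative is the second difference of [s], that is a first
    difference of [theta y = s (y+1) - s y]. The associated steps are [B (y+1) - B y] and
    [s (y+1)]. *)
Lemma smooth_partition : exists (eta : nat -> R -> R) (theta D1 D2 : R -> R),
  [/\ forall k (y : R), is_derive y 1 (eta k) (eta k.+1 y),
      forall y, eta 1%N y = theta y - theta (y - 1),
      is_step D1 /\ is_step D2,
      forall y, eta 0%N y = D1 y - D1 (y - 1) &
      forall y, theta y = D2 y - D2 (y - 1)].
Proof.
pose st (pm : {poly R} * nat) := (bump_step pm.1 pm.2, pm.2.+2).
pose rho k := bumpfun (iter k st (1, 0%N)).1 (iter k st (1, 0%N)).2.
have drho k (y : R) : is_derive y 1 (rho k) (rho k.+1 y) by exact: is_derive_bumpfun.
have rho0N k y : ~~ (0 < y < 1) -> rho k y = 0 by rewrite /rho /bumpfun => /negbTE ->.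
have rho_ge0 y : 0 <= rho 0%N y.
  by rewrite /rho /bumpfun /=; case: ifP => // _; rewrite hornerC expr0 mulr1 mul1r expR_ge0.
have [s0 s0N ds0] : exists2 F : R -> R, (forall y, y <= 0 -> F y = 0) &
    forall y : R, is_derive y 1 F (rho 0%N y).
  apply: antiderivative; first exact: continuous_der (drho 0%N).
  by move=> y y0; apply: rho0N; rewrite negb_and -!leNgt y0.
pose c := s0 1.
have c0 : 0 < c.
  have [d /andP[d0 d1]] := mvt1 (@ltr01 R) ds0; rewrite (s0N 0)// !subr0 mulr1 /c => ->.
  by rewrite /rho /bumpfun /= d0 d1 /= hornerC expr0 mulr1 mul1r expR_gt0.
pose s y := c^-1 * s0 y.
have ds (y : R) : is_derive y 1 s (c^-1 * rho 0%N y) by apply: derZ; exact: ds0.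
have sN y : y <= 0 -> s y = 0 by move=> y0; rewrite /s s0N// mulr0.
have s1 y : 1 <= y -> s y = 1.
  rewrite le_eqVlt => /predU1P[<-|y1]; first by rewrite /s mulVf// gt_eqF.
  have [d /andP[d1 _]] := mvt1 y1 ds; rewrite rho0N ?mulr0 ?mul0r.
    by move/subr0_eq => ->; rewrite /s mulVf// gt_eqF.
  by rewrite negb_and -!leNgt (ltW d1) orbT.
have sh : {homo s : x y / x <= y}.
  by apply: is_derive_ge0_homo ds _ => y; rewrite mulr_ge0// invr_ge0 ltW.
have [B BN dB] := antiderivative (continuous_der ds) sN.
have s01 y : 0 <= s y by have [/sN ->//|/ltW/sh] := leP y 0; rewrite (sN 0).
pose Bk k := match k with 0%N => B | 1%N => s | k.+2 => fun y => c^-1 * rho k y end.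
have dBk k (y : R) : is_derive y 1 (Bk k) (Bk k.+1 y).
  by case: k => [|[|k]] //=; apply: derZ; exact: drho.
have shift k (a y : R) : is_derive y 1 (fun y => Bk k (y + a)) (Bk k.+1 (y + a)).
  have da : is_derive y 1 (fun y : R => y + a) 1.
    by have := derD (is_derive_id y 1) (@is_derive_cst R R R a y 1); rewrite addr0.
  by have := @der_comp _ _ _ _ (fun y => y + a) _ _ (dBk k (y + a)) da; rewrite mulr1.
pose D1 y := B (y + 1) - B y.
pose eta k y := (Bk k (y + 1) - Bk k y) - (Bk k y - Bk k (y + -1)).
exists eta, (fun y => s (y + 1) - s y), D1, (fun y => s (y + 1)).
have dD1 (y : R) : is_derive y 1 D1 (s (y + 1) - s y).
  exact: derB (shift 0%N 1 y) (dB y).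
split.
- move=> k y; exact: derB (derB (shift k 1 y) (dBk k y)) (derB (dBk k y) (shift k (-1) y)).
- by move=> y; rewrite /eta /= subrK.
- split; split.
  + by apply: is_derive_ge0_homo dD1 _ => y; rewrite subr_ge0 sh// lerDl.
  + by move=> y y1; rewrite /D1 !BN ?subrr//; lra.
  + move=> y y1; have yy : y < y + 1 by rewrite ltrDl.
    have [d /andP[yd _]] := mvt1 yy dB; rewrite /D1 => ->.
    have -> : s d = 1 by rewrite s1// (le_trans y1)// ltW.
    by ring.
  + by move=> x y xy; rewrite sh// lerD2r.
  + by move=> y y1; rewrite sN//; lra.
  + by move=> y y1; rewrite s1//; lra.
- by move=> y; rewrite /eta /D1 /= subrK.
- by move=> y; rewrite subrK.
Qed.

End Bump.

(** * Differentiable functions of compact support *)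

Section C1.
Variable R : realType.

Definition C1_supp n (L : nat) (f : 'rV[R]_n -> R) :=
  cont_supp L f /\ forall i, (forall x, derivable f x (evec R i)) /\ cont_supp L (pderiv i f).

Lemma is_derive_line_at (V : normedModType R) (f : V -> R) x v (t df : R) :
  is_derive (t *: v + x) v f df -> is_derive t 1 (fun s => f (s *: v + x)) df.
Proof.
move=> /is_derive_line H; apply/is_derive_line.
rewrite (_ : (fun _ => _) = (fun s => f (s *: v + (t *: v + x))))//.
by apply/funext => s; rewrite addrA -scalerDl [s *: 1]mulr1.
Qed.

Lemma is_derive_continuous (f : R -> R) (x df : R) : is_derive x 1 f df ->
  {for x, continuous f}.
Proof.
move=> dF; apply: differentiable_continuous.
by apply/derivable1_diffP; exact: ex_derive.
Qed.

Lemma dquot_mvt n N (i : 'I_n) (f : 'rV[R]_n -> R) x : (0 < N)%N ->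
  (forall x, derivable f x (evec R i)) ->
  exists2 c, 0 < c < N%:R^-1 & dquot N i f x = pderiv i f (c *: evec R i + x).
Proof.
move=> N0 df; have Np : 0 < N%:R^-1 :> R by rewrite invr_gt0 ltr0n.
have dF (t : R) : is_derive t 1 (fun s => f (s *: evec R i + x)) (pderiv i f (t *: evec R i + x)).
  by apply: is_derive_line_at; apply: derivableP.
have [c c01 E] := mvt1 Np dF; exists c => //.
rewrite scale0r add0r subr0 in E.
by rewrite /dquot [x + _]addrC E mulrC mulfVK// pnatr_eq0 -lt0n.
Qed.

(** The derivative is taken at a nearby [y] rather than at [x], because in the lattice approximation
    the quotients sit at lattice points. *)
Lemma dquot_close n L (f : 'rV[R]_n -> R) (e : R) : C1_supp L f -> 0 < e ->
  exists2 d, 0 < d & forall N i (x y : 'rV[R]_n), (0 < N)%N -> N%:R^-1 <= d ->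
    (forall j, `|x 0 j - y 0 j| <= d) -> `|dquot N i f x - pderiv i f y| <= e.
Proof.
move=> [_ Cf] e0.
have H i : exists d, 0 < d /\ forall x y : 'rV[R]_n,
    (forall j, `|x 0 j - y 0 j| <= d) -> `|pderiv i f x - pderiv i f y| <= e.
  by have [d d0 dP] := cont_supp_unif (Cf i).2 e0; exists d.
have [d dP] := choice H.
pose m := \big[Num.min/1]_i d i.
have m0 : 0 < m by apply/bigmin_gtP; split=> // i _; exact: (dP i).1.
exists (m / 2); first by rewrite divr_gt0.
move=> N i x y N0 Nm xy.
have [c /andP[c0 c1] ->] := dquot_mvt x N0 (Cf i).1.
apply: (dP i).2 => j; rewrite (@le_trans _ _ m)//; last exact: bigmin_le_cond.
rewrite !mxE eqxx /= -addrA (le_trans (ler_normD _ _))// [leRHS]splitr lerD//.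
rewrite normrM gtr0_norm// (le_trans _ Nm)// (@le_trans _ _ c) ?(ltW c1)//.
by rewrite ler_piMr ?(ltW c0)//; case: eqP => _; rewrite ?normr1 ?normr0.
Qed.

Lemma rsum_close n L N (f g : 'rV[R]_n -> R) (e : R) : (0 < L)%N -> (0 < N)%N ->
  (forall x, `|f x - g x| <= e) ->
  `|rsum L N f - rsum L N g| <= e * (L.*2)%:R ^+ n.
Proof.
move=> L0 N0 fg.
have H (f1 f2 : 'rV[R]_n -> R) : (forall x, `|f1 x - f2 x| <= e) ->
    rsum L N f1 - rsum L N f2 <= e * (L.*2)%:R ^+ n.
  move=> f12; rewrite lerBlDl.
  have <- : rsum L N (fun _ : 'rV[R]_n => e) = e * (L.*2)%:R ^+ n.
    by rewrite /rsum gsums_cst// size_enum_ord mulrC.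
  rewrite -rsumD; apply: gsums_le; last exact: (ingrid_corner _ L0 N0).
  move=> x _.
  by rewrite -lerBlDl (le_trans (ler_norm _)).
rewrite ler_norml H// andbT lerNl opprB H// => x.
by rewrite distrC.
Qed.

(** The summand may vary with [N]: difference quotients use the mesh of the grid as their step,
    which is what makes the telescoping exact before the limit. *)
Lemma cvg_rsum_unif n L (f : 'rV[R]_n -> R) (F : nat -> 'rV[R]_n -> R) :
  (0 < L)%N -> cont_supp L f ->
  (forall e, 0 < e -> \forall N \near \oo, forall x, `|F N x - f x| <= e) ->
  rsum L N (F N) @[N --> \oo] --> integral_Rn f.
Proof.
move=> L0 Cf H.
have K : (rsum L N (F N) - rsum L N f) @[N --> \oo] --> (0 : R).
  apply/cvgrPdist_le => e e0; set c : R := (L.*2)%:R ^+ n.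
  have c0 : 0 <= c by rewrite exprn_ge0.
  have ec0 : 0 < e / (c + 1) by rewrite divr_gt0// ltr_wpDl.
  have HN := H _ ec0.
  near=> N.
  have N0 : (0 < N)%N by near: N; exact: nbhs_infty_gt.
  have FN : forall x, `|F N x - f x| <= e / (c + 1) by near: N.
  rewrite sub0r normrN (le_trans (rsum_close L0 N0 FN))// -/c.
  by rewrite mulrAC ler_pdivrMr ?ltr_wpDl// ler_wpM2l ?(ltW e0)// lerDl.
rewrite (_ : (fun _ => _) = fun N => (rsum L N (F N) - rsum L N f) + rsum L N f).
  rewrite -[integral_Rn f]add0r; apply: cvgD; [exact: K|exact: cvg_rsum].
by apply/funext => N; rewrite subrK.
Unshelve. all: by end_near. Qed.

Lemma dquot_unif n L (f : 'rV[R]_n -> R) i : C1_supp L f ->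
  forall e, 0 < e -> \forall N \near \oo, forall x, `|dquot N i f x - pderiv i f x| <= e.
Proof.
move=> Cf e e0; have [d d0 dP] := dquot_close Cf e0.
near=> N; move=> x; apply: dP.
- by near: N; exact: nbhs_infty_gt.
- by near: N; exact: near_invn.
- by move=> j; rewrite subrr normr0 ltW.
Unshelve. all: by end_near. Qed.

Lemma cont_supp_comp n L (f : 'rV[R]_n -> R) (h : R -> R) :
  cont_supp L f -> continuous h -> h 0 = 0 -> cont_supp L (fun x => h (f x)).
Proof.
move=> [cf f0] ch h0; split=> [x|x i xi]; last by rewrite (f0 _ i).
by apply: continuous_comp; [exact: cf|exact: ch].
Qed.

Lemma cont_supp_norm n L (f : 'rV[R]_n -> R) :
  cont_supp L f -> cont_supp L (fun x => `|f x|).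
Proof.
by move=> Cf; apply: cont_supp_comp => //; [exact: norm_continuous|rewrite normr0].
Qed.

Lemma integral_pderiv0 n L (f : 'rV[R]_n -> R) i : (0 < L)%N -> C1_supp L f ->
  integral_Rn (pderiv i f) = 0.
Proof.
move=> L0 Cf; have H := cvg_rsum_unif L0 (Cf.2 i).2 (dquot_unif i Cf).
rewrite -(cvg_lim (@Rhausdorff R) H); apply: cvg_lim => //.
apply: (@cvg_trans _ ((fun _ : nat => 0 : R) @ \oo)); last exact: cvg_cst.
apply: near_eq_cvg; near=> N; rewrite rsum_dquot//.
- by near: N; exact: nbhs_infty_gt.
- by move=> x; apply: Cf.1.2.
Unshelve. all: by end_near. Qed.

Lemma continuous_norm_powR p : 0 < p -> continuous (fun t : R => `|t| `^ p).
Proof.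
move=> p0 t; have [->|t0] := eqVneq t 0.
  apply/cvgrPdist_le => e e0; rewrite normr0 powR0 ?gt_eqF//.
  have r0 : 0 < e `^ p^-1 by rewrite powR_gt0.
  apply/nbhs_ballP; exists (e `^ p^-1) => //= s se. have {}se : `|s| < e `^ p^-1 by move: se; rewrite /ball/= sub0r normrN.
  rewrite sub0r normrN ger0_norm ?powR_ge0//.
  have -> : e = (e `^ p^-1) `^ p by rewrite -powRrM mulVf ?gt_eqF// powRr1// ltW.
  by rewrite ge0_ler_powR ?nnegrE ?powR_ge0 ?(ltW p0)// ltW.
apply: (@continuous_comp _ _ _ (fun t : R => `|t|) (@powR R ^~ p)).
  exact: norm_continuous.
by apply: is_derive_continuous (is_derive1_powR p _); rewrite normr_gt0.
Qed.

Lemma gagliardo_nirenberg n L (f : 'rV[R]_n -> R) : (1 < n)%N -> (0 < L)%N ->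
  C1_supp L f ->
  integral_Rn (fun x => `|f x| `^ (n%:R / (n%:R - 1))) ^+ n.-1 <=
  \prod_i integral_Rn (fun x => `|pderiv i f x|).
Proof.
move=> n1 L0 Cf.
have p0 : 0 < n%:R / (n%:R - 1) :> R.
  by rewrite divr_gt0 ?ltr0n ?(ltn_trans _ n1)// subr_gt0 ltr1n.
have Cw : cont_supp L (fun x => `|f x| `^ (n%:R / (n%:R - 1))).
  apply: (@cont_supp_comp _ _ _ (fun t => `|t| `^ (n%:R / (n%:R - 1)))) => //.
  - exact: Cf.1.
  - exact: continuous_norm_powR.
  - by rewrite normr0 powR0// gt_eqF.
have H1 := cvg_rsum L0 Cw.
have H2 i : rsum L N (fun x => `|dquot N i f x|) @[N --> \oo] --> integral_Rn (fun x => `|pderiv i f x|).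
  apply: cvg_rsum_unif => //; first exact: cont_supp_norm (Cf.2 i).2.
  move=> e e0; near=> N; move=> x; apply: le_trans (ler_dist_dist _ _) _.
  by move: x; near: N; exact: (dquot_unif i Cf e0).
have H1n : (rsum L N (fun x => `|f x| `^ (n%:R / (n%:R - 1)))) ^+ n.-1 @[N --> \oo] -->
    integral_Rn (fun x => `|f x| `^ (n%:R / (n%:R - 1))) ^+ n.-1.
  exact: (cvg_comp _ _ H1 (@exprn_continuous R n.-1 _)).
have H2n : \prod_i rsum L N (fun x => `|dquot N i f x|) @[N --> \oo] -->
    \prod_i integral_Rn (fun x => `|pderiv i f x|).
  apply: cvg_big => [|i _]; [exact: mul_continuous|exact: H2].
apply: ler_cvg_to H1n H2n _; near=> N.
apply: discrete_sobolev => //; last by move=> x i; exact: Cf.1.2.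
by near: N; exact: nbhs_infty_gt.
Unshelve. all: by end_near. Qed.

End C1.

(** * Smooth approximation in C^1 *)

Section Lattice.
Variable R : realType.

Lemma der_tensor n (H : 'I_n -> R -> R) (x : 'rV[R]_n) j (d : R) :
  is_derive (x 0 j) 1 (H j) d ->
  is_derive x (evec R j) (fun y => \prod_i H i (y 0 i))
    (d * \prod_(i | i != j) H i (x 0 i)).
Proof.
move=> dH; apply/is_derive_line.
have E i (t : R) : i != j -> (t *: evec R j + x) 0 i = x 0 i.
  by move=> ij; rewrite !mxE (negbTE ij) mulr0 add0r.
have Ej (t : R) : (t *: evec R j + x) 0 j = t *: 1 + x 0 j.
  by rewrite !mxE !eqxx.
rewrite (_ : (fun t => _) = fun t => \prod_(i | i != j) H i (x 0 i) * H j (t *: 1 + x 0 j)).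
  by rewrite mulrC; apply: derZ; apply/is_derive_line.
apply/funext => t; rewrite (bigD1 j)//= Ej mulrC; congr (_ * _).
by apply: eq_bigr => i ij; rewrite E.
Qed.

Lemma continuous_tensor n (H : 'I_n -> R -> R) : (forall i, continuous (H i)) ->
  continuous (fun y : 'rV[R]_n => \prod_i H i (y 0 i)).
Proof.
move=> cH; apply: (@continuous_big R _ _ _ _ (@mul_continuous R)) => i _ y.
by apply: continuous_comp; [exact: coord_continuous|exact: cH].
Qed.

Definition lpt n L N (k : {ffun 'I_n -> 'I_(L.*2 * N)}) : 'rV[R]_n :=
  \row_i node R L N (k i).

(** [m] records how often [eta] has been differentiated in each coordinate, and [N ^+ m i] is the
    chain rule factor. All partial derivatives stay in this family, so smoothness of every order
    follows from [der_lattice_sum]. *)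
Definition lattice_sum n (eta : nat -> R -> R) L N (g : 'rV[R]_n -> R)
    (m : 'I_n -> nat) (x : 'rV[R]_n) : R :=
  \sum_(k : {ffun 'I_n -> 'I_(L.*2 * N)}) g (lpt k) *
    \prod_i (N%:R ^+ m i * eta (m i) (N%:R * (x 0 i - node R L N (k i)))).

Section Smoothness.
Variables (n L N : nat) (eta : nat -> R -> R) (g : 'rV[R]_n -> R).
Hypothesis deta : forall k (y : R), is_derive y 1 (eta k) (eta k.+1 y).

Let incr (j : 'I_n) (m : 'I_n -> nat) i := (m i + (i == j))%N.

Lemma der_eta_scale m a (y : R) :
  is_derive y 1 (fun t => N%:R ^+ m * eta m (N%:R * (t - a)))
    (N%:R ^+ m.+1 * eta m.+1 (N%:R * (y - a))).
Proof.
have d1 : is_derive y 1 (fun t : R => N%:R * (t - a)) N%:R.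
  have := derZ N%:R (derB (is_derive_id y 1) (@is_derive_cst R R R a y 1)).
  by rewrite subr0 mulr1.
have := derZ (N%:R ^+ m) (@der_comp _ _ _ _ _ (fun t => N%:R * (t - a)) _ _ (deta m _) d1).
by rewrite exprSr -mulrA [_ * eta _ _]mulrC mulrA.
Qed.

Lemma der_lattice_sum m j x :
  is_derive x (evec R j) (lattice_sum eta L N g m) (lattice_sum eta L N g (incr j m) x).
Proof.
apply: der_sum => k; apply: derZ.
have H := @der_tensor n (fun i t => N%:R ^+ m i * eta (m i) (N%:R * (t - node R L N (k i))))
  x j _ (der_eta_scale _ _ _).
apply: der_eq H _; rewrite [RHS](bigD1 j)//= /incr eqxx addn1; congr (_ * _).
by apply: eq_bigr => i /negbTE ->; rewrite addn0.
Qed.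

Lemma pderivs_lattice_sum m s :
  pderivs s (lattice_sum eta L N g m) = lattice_sum eta L N g (foldr incr m s).
Proof.
elim: s => //= j s ->; apply/funext => x; rewrite /pderiv.
by have H := der_lattice_sum (foldr incr m s) j x; rewrite derive_val.
Qed.

Lemma continuous_lattice_sum m : continuous (lattice_sum eta L N g m).
Proof.
apply: (continuous_big (op := +%R) (x0 := 0) (P := xpredT)) => [|k _ x].
  exact: add_continuous.
apply: continuousM; first exact: cst_continuous.
apply: (@continuous_tensor n (fun i t => N%:R ^+ m i * eta (m i) (N%:R * (t - node R L N (k i))))).
by move=> i y; exact: is_derive_continuous (der_eta_scale _ _ _).
Qed.

Lemma Cinf_lattice_sum m : Cinf_on setT (lattice_sum eta L N g m).
Proof.
move=> K; split=> s _ => [i x _|x _]; rewrite pderivs_lattice_sum.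
  by apply: ex_derive; exact: der_lattice_sum.
exact: continuous_lattice_sum.
Qed.

End Smoothness.

Lemma step_bounds D : is_step D ->
  (forall y : R, 0 <= D y - D (y - 1)) /\ (forall y : R, D y - D (y - 1) != 0 -> `|y| <= 2).
Proof.
move=> [Dh D0 D1]; split=> y; first by rewrite subr_ge0 Dh// gerBl.
apply: contraNle; rewrite ltr_normr => /orP[y2|y2].
  by rewrite !D1 ?subrr//; lra.
by rewrite !D0 ?subrr//; lra.
Qed.

(** The weights are nonnegative, sum to one, and vanish unless the lattice point is within [2/N] of
    [x] in each coordinate, so the sum is an average of values [c k] close to [a]. The second
    alternative covers points near the edge of the box, where the lattice is cut off and the weights
    need not sum to one. [W] may vary with the coordinate, since a derivative in direction [j]
    carries [theta] there and [eta] elsewhere. *)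
Lemma lattice_average n (L N : nat) (W D : 'I_n -> R -> R) (x : 'rV[R]_n)
    (c : {ffun 'I_n -> 'I_(L.*2 * N)} -> R) (a e : R) :
  (0 < N)%N -> 0 <= e ->
  (forall i, is_step (D i)) -> (forall i y, W i y = D i y - D i (y - 1)) ->
  (forall k : {ffun 'I_n -> 'I_(L.*2 * N)}, (forall i, `|x 0 i - node R L N (k i)| <= 2 / N%:R) -> `|c k - a| <= e) ->
  (forall i, `|x 0 i| <= L%:R - N%:R^-1) \/
  (a = 0 /\ forall k : {ffun 'I_n -> 'I_(L.*2 * N)}, (forall i, `|x 0 i - node R L N (k i)| <= 2 / N%:R) -> c k = 0) ->
  `|\sum_k c k * \prod_i W i (N%:R * (x 0 i - node R L N (k i))) - a| <= e.
Proof.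
move=> N0 e0 Dstep WD ca hyp.
have Np : 0 < N%:R :> R by rewrite ltr0n.
pose w (k : {ffun 'I_n -> 'I_(L.*2 * N)}) :=
  \prod_i W i (N%:R * (x 0 i - node R L N (k i))).
have w0 k : 0 <= w k.
  by apply: prodr_ge0 => i _; rewrite WD; apply: (step_bounds (Dstep i)).1.
have wnear k : w k != 0 -> forall i, `|x 0 i - node R L N (k i)| <= 2 / N%:R.
  move=> wk i; rewrite ler_pdivlMr// -[N%:R in X in X <= _]gtr0_norm// -normrM mulrC.
  apply: (step_bounds (Dstep i)).2; rewrite -WD.
  by apply: contra wk => /eqP H; rewrite /w (bigD1 i)//= H mul0r.
case: hyp => [xin|[a0 c0]]; last first.
  rewrite a0 subr0 big1 ?normr0// => k _.
  by have [wk|/wnear/c0->] := eqVneq (w k) 0; rewrite ?mul0r// -/(w k) wk mulr0.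
have w1 : \sum_k w k = 1.
  rewrite /w -(bigA_distr_bigA (fun i (j : 'I_(L.*2 * N)) => W i (N%:R * (x 0 i - node R L N j)))).
  apply: big1 => i _; set z := N%:R * (x 0 i + L%:R).
  have zE j : N%:R * (x 0 i - node R L N j) = z - j%:R.
    by rewrite /z /node; field; rewrite gt_eqF.
  rewrite (eq_bigr (fun j : 'I_(L.*2 * N) => - (D i (z - j.+1%:R) - D i (z - j%:R)))); last first.
    by move=> j _; rewrite zE WD opprB -natr1 opprD addrA.
  rewrite sumrN -(big_mkord predT (fun j => D i (z - j.+1%:R) - D i (z - j%:R))) telescope_sumr//.
  (* The telescoped sum is [D i z - D i (z - 2LN)]. The margin [1/N] gives [1 <= z <= 2LN - 1],
     which is where the two values are one and zero. *)
  have /andP[x1 x2] : - (L%:R - N%:R^-1) <= x 0 i <= L%:R - N%:R^-1 by rewrite -ler_norml.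
  have NN : N%:R * N%:R^-1 = 1 :> R by rewrite mulfV// gt_eqF.
  have [_ Dlo Dhi] := Dstep i.
  rewrite Dlo; last first.
    by rewrite /z natrM -addnn natrD; nra.
  by rewrite subr0 Dhi; [rewrite sub0r opprK|rewrite /z; nra].
rewrite (_ : _ - a = \sum_k (c k - a) * w k); last first.
  under [RHS]eq_bigr do rewrite mulrBl.
  by rewrite sumrB -mulr_sumr w1 mulr1.
apply: le_trans (ler_norm_sum _ _ _) _.
rewrite -[e]mulr1 -w1 mulr_sumr; apply: ler_sum => k _.
rewrite normrM [`|w k|]ger0_norm//.
have [->|/wnear/ca ?] := eqVneq (w k) 0; first by rewrite !mulr0.
by rewrite ler_wpM2r.
Qed.

(** The shift is cyclic so that it is a bijection of the finite index set; the wrapped-around terms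
    vanish because [g] is zero near the edge of the box. *)
Definition shift_ord n M (j : 'I_n) (k : {ffun 'I_n -> 'I_M}) : {ffun 'I_n -> 'I_M} :=
  [ffun i => if i == j then ordS (k i) else k i].

Lemma shift_ord_bij n M (j : 'I_n) : bijective (@shift_ord n M j).
Proof.
exists (fun k : {ffun 'I_n -> 'I_M} => [ffun i => if i == j then ord_pred (k i) else k i]) => k;
  apply/ffunP => i; rewrite !ffunE; case: eqP => //.
- by rewrite ordSK.
- by rewrite ord_predK.
Qed.

(* Summation by parts: the derivative of the lattice sum is a weighted average
   of difference quotients of [g]. *)
Lemma pderiv_lattice_sum n L' N (eta : nat -> R -> R) (theta : R -> R)
    (g : 'rV[R]_n -> R) (j : 'I_n) (x : 'rV[R]_n) :
  let L := L'.+1 in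
  (0 < N)%N -> (forall (y : 'rV[R]_n) i, L'%:R <= `|y 0 i| -> g y = 0) ->
  (forall y, eta 1%N y = theta y - theta (y - 1)) ->
  lattice_sum eta L N g (fun i => (i == j : nat)) x =
  \sum_(k : {ffun 'I_n -> 'I_(L.*2 * N)}) dquot N j g (lpt k - N%:R^-1 *: evec R j) *
    \prod_i (if i == j then theta else eta 0%N) (N%:R * (x 0 i - node R L N (k i))).
Proof.
move=> L N0 g0 Eeta.
have Np : 0 < N%:R :> R by rewrite ltr0n.
pose z (k : {ffun 'I_n -> 'I_(L.*2 * N)}) i := N%:R * (x 0 i - node R L N (k i)).
pose pr k := \prod_(i | i != j) eta 0%N (z k i).
have E1 : lattice_sum eta L N g (fun i => (i == j : nat)) x =
    N%:R * (\sum_k g (lpt k) * (theta (z k j) * pr k))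
    - N%:R * (\sum_k g (lpt k) * (theta (z k j - 1) * pr k)).
  rewrite -mulrBr -sumrB mulr_sumr; apply: eq_bigr => k _.
  rewrite (bigD1 j)//= eqxx Eeta -/(z k j) expr1.
  rewrite (eq_bigr (fun i => eta 0%N (z k i))); last first.
    by move=> i /negbTE ->; rewrite mul1r.
  by rewrite -/(pr k); ring.
have E2 : \sum_k g (lpt k) * (theta (z k j - 1) * pr k) =
    \sum_k g (lpt k - N%:R^-1 *: evec R j) * (theta (z k j) * pr k).
  rewrite [RHS](reindex (@shift_ord n (L.*2 * N) j)); last exact: (onW_bij _ (@shift_ord_bij _ _ j)).
  apply: eq_bigr => k _.
  have -> : pr (shift_ord j k) = pr k.
    by apply: eq_bigr => i ij; rewrite /z ffunE (negbTE ij).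
  have [kM|kM] := ltnP (k j).+1 (L.*2 * N).
    have Ek : node R L N (shift_ord j k j) = node R L N (k j) + N%:R^-1.
      by rewrite nodeS ffunE eqxx /= modn_small.
    have -> : z (shift_ord j k) j = z k j - 1.
      by rewrite /z Ek; field; rewrite gt_eqF.
    congr (g _ * _); apply/rowP => i; rewrite !mxE eqxx /=.
    case: eqP => [->|/eqP ij]; first by rewrite Ek mulr1 addrK.
    by rewrite ffunE (negbTE ij) mulr0 subr0.
  (* Wrapped index: on the left the point has coordinate [L - 1/N], on the right [-L - 1/N]. As
     [L = L' + 1], both are at least [L'] in absolute value and [g] vanishes there. *)
  have kE : (k j).+1 = (L.*2 * N)%N by apply/eqP; rewrite eqn_leq kM ltn_ord.
  have N1 : N%:R^-1 <= 1 :> R by rewrite invf_le1// ler1n.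
  have Ni : 0 < N%:R^-1 :> R by rewrite invr_gt0.
  have L0 : 0 <= L'%:R :> R by rewrite ler0n.
  rewrite (g0 (lpt k) j) ?mul0r; last first.
    have := @nodeS R L N (k j); rewrite kE node_last// => /(canRL (addrK _)) H.
    by rewrite mxE H ger0_norm /L -natr1; lra.
  rewrite (g0 _ j) ?mul0r// !mxE !eqxx ffunE eqxx /= kE modnn node0 mulr1.
  by rewrite ler0_norm /L -natr1; lra.
rewrite E1 E2 -mulrBr -sumrB mulr_sumr; apply: eq_bigr => k _.
rewrite /dquot subrK -mulrBl -mulrA; congr (_ * (_ * _)).
rewrite [RHS](bigD1 j)//= eqxx; congr (_ * _).
by apply: eq_bigr => i /negbTE ->.
Qed.

Lemma smooth_approx n L (g : 'rV[R]_n -> R) (e : R) : C1_supp L g -> 0 < e ->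
  exists psi : 'rV[R]_n -> R,
  [/\ Cinf_on setT psi, forall x, `|psi x - g x| <= e,
      forall i x, `|pderiv i psi x - pderiv i g x| <= e &
      forall x : 'rV[R]_n, psi x != 0 -> exists2 y : 'rV[R]_n, g y != 0 & forall i, `|x 0 i - y 0 i| <= e].
Proof.
move=> Cg e0.
have [eta [theta [D1 [D2 [deta Eeta [sD1 sD2] EW1 EW2]]]]] := smooth_partition R.
have [d1 d10 d1P] := cont_supp_unif Cg.1 e0.
have [d2 d20 d2P] := dquot_close Cg e0.
(* The factor 4 keeps [4/N] below every tolerance: a lattice point of nonzero weight is within [2/N]
   of [x], the step of the quotient adds [1/N], and the margin at the edge of the enlarged box
   another [1/N]. *)
pose d := Num.min (Num.min e d1) (Num.min d2 1) / 4.
have d0 : 0 < d by rewrite divr_gt0// !lt_min e0 d10 d20 ltr01.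
have [N [N0 Nd]] : exists N, (0 < N)%N /\ N%:R^-1 <= d.
  have [N _ H] := near_invn d0.
  by exists N.+1; split=> //; apply: H; rewrite /= leqnSn.
have Np : 0 < N%:R^-1 :> R by rewrite invr_gt0 ltr0n.
have : N%:R^-1 * 4 <= Num.min (Num.min e d1) (Num.min d2 1) by rewrite -ler_pdivlMr.
rewrite !le_min => /andP[/andP[Ne Nd1] /andP[Nd2 N1]].
pose psi := lattice_sum eta L.+1 N g (fun=> 0%N).
have psiE x : psi x = \sum_(k : {ffun 'I_n -> 'I_(L.+1.*2 * N)}) g (lpt k) *
    \prod_i eta 0%N (N%:R * (x 0 i - node R L.+1 N (k i))).
  by apply: eq_bigr => k _; congr (_ * _); apply: eq_bigr => i _; rewrite mul1r.
have inner (x : 'rV[R]_n) : (forall i, `|x 0 i| <= L.+1%:R - N%:R^-1) \/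
    (exists i, L.+1%:R - N%:R^-1 < `|x 0 i|).
  have [|/existsNP[i /negP]] := pselect (forall i, `|x 0 i| <= L.+1%:R - N%:R^-1).
    by left.
  by rewrite -ltNge; right; exists i.
have far (x y : 'rV[R]_n) i : L.+1%:R - N%:R^-1 < `|x 0 i| ->
    `|x 0 i - y 0 i| <= 3 * N%:R^-1 -> L%:R <= `|y 0 i|.
  move=> xi xy; have := ler_dist_dist (x 0 i) (y 0 i).
  move=> /(le_trans (ler_norm _)); move: xi; rewrite -natr1; lra.
have lptE (k : {ffun 'I_n -> 'I_(L.+1.*2 * N)}) i : lpt k 0 i = node R L.+1 N (k i).
  by rewrite mxE.
exists psi; split.
- exact: Cinf_lattice_sum.
- move=> x; rewrite psiE.
  apply: (@lattice_average n L.+1 N (fun=> eta 0%N) (fun=> D1)) => //; first exact: ltW.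
    move=> k xk; apply: d1P => i; rewrite distrC lptE (le_trans (xk i))//.
    by lra.
  have [|[i xi]] := inner x; [by left|right; split].
    apply: (Cg.1.2 _ i); apply: (far x) xi _; rewrite subrr normr0; lra.
  move=> k xk; apply: (Cg.1.2 _ i); apply: (far x) xi _.
  by rewrite lptE (le_trans (xk i))//; lra.
- move=> j x.
  have -> : pderiv j psi x = lattice_sum eta L.+1 N g (fun i => (i == j : nat)) x.
    have := @pderivs_lattice_sum n L.+1 N eta g deta (fun=> 0%N) [:: j].
    by move=> /= ->.
  rewrite (@pderiv_lattice_sum n L N eta theta)//; last exact: Cg.1.2.
  pose p (k : {ffun 'I_n -> 'I_(L.+1.*2 * N)}) := lpt k - N%:R^-1 *: evec R j.
  have pk (k : {ffun 'I_n -> 'I_(L.+1.*2 * N)}) i : `|x 0 i - node R L.+1 N (k i)| <= 2 / N%:R -> `|x 0 i - p k 0 i| <= 3 * N%:R^-1.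
    move=> xk; rewrite /p !mxE eqxx /= opprD addrA opprK.
    have -> : 3 * N%:R^-1 = 2 / N%:R + N%:R^-1 :> R by ring.
    rewrite (le_trans (ler_normD _ _))// lerD//.
    rewrite normrM gtr0_norm// ler_piMr ?(ltW Np)//.
    by case: eqP => _; rewrite ?normr1 ?normr0.
  apply: (@lattice_average n L.+1 N (fun i => if i == j then theta else eta 0%N)
    (fun i => if i == j then D2 else D1)) => //; first exact: ltW.
  + by move=> i; case: eqP.
  + by move=> i y; case: eqP.
  + move=> k xk; apply: d2P => //; first lra.
    move=> i; rewrite distrC (le_trans (pk _ _ (xk i)))//; lra.
  have [|[i xi]] := inner x; [by left|right; split].
    apply: ((Cg.2 j).2.2 _ i); apply: (far x) xi _; rewrite subrr normr0; lra.
  move=> k xk; rewrite /dquot subrK (Cg.1.2 _ i); last first.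
    by apply: (far x) xi _; rewrite lptE (le_trans (xk i))//; lra.
  rewrite (Cg.1.2 _ i) ?subrr ?mulr0//.
  by apply: (far x) xi _; exact: pk.
- move=> x; rewrite psiE => px.
  have [k] : exists k : {ffun 'I_n -> 'I_(L.+1.*2 * N)}, g (lpt k) *
      \prod_i eta 0%N (N%:R * (x 0 i - node R L.+1 N (k i))) != 0.
    apply/existsP; apply: contraNT px => /existsPn H.
    by rewrite big1// => k _; apply/eqP; rewrite -[_ == _]negbK H.
  rewrite mulf_eq0 negb_or => /andP[gk wk]; exists (lpt k) => // i.
  rewrite lptE (@le_trans _ _ (2 * N%:R^-1))//; last lra.
  have Nr : 0 < N%:R :> R by rewrite ltr0n.
  rewrite ler_pdivlMr// -[N%:R in X in X <= _]gtr0_norm// -normrM mulrC.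
  apply: (step_bounds sD1).2; rewrite -EW1.
  by apply: contra wk => /eqP H; rewrite (bigD1 i)//= H mul0r.
Qed.

End Lattice.

(** * Extension by zero *)

Section Ext.
Variable R : realType.

Lemma near_eq_continuous (T U : topologicalType) (f g : T -> U) x :
  (\forall y \near x, f y = g y) -> {for x, continuous f} -> {for x, continuous g}.
Proof.
move=> E cf; rewrite /prop_for /continuous_at -(nbhs_singleton E).
by apply: cvg_trans cf; exact: near_eq_cvg.
Qed.

Lemma coord_le_norm n (x : 'rV[R]_n) i : `|x 0 i| <= `|x|.
Proof.
by rewrite [leRHS]/Num.norm /= mx_normrE; apply/bigmax_geP; right => /=; exists (0, i).
Qed.

Lemma compact_box n (K : set 'rV[R]_n) : compact K ->
  exists2 L : nat, (0 < L)%N & forall x, K x -> forall i, `|x 0 i| < L%:R.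
Proof.
move=> /compact_bounded[M [Mr HM]].
have [L ML] : exists L : nat, M + 1 < L%:R.
  by exists (Num.bound `|M + 1|); rewrite (le_lt_trans (ler_norm _))// archi_boundP.
exists L.+1 => // x Kx i.
rewrite (le_lt_trans (coord_le_norm _ _))// (@le_lt_trans _ _ (M + 1))//.
  by apply: HM => //; rewrite ltrDl.
by rewrite (lt_trans ML)// ltr_nat.
Qed.

Lemma compact_margin n (K Omega : set 'rV[R]_n) : compact K -> open Omega ->
  K `<=` Omega ->
  exists2 d : R, 0 < d &
    forall x y : 'rV[R]_n, K y -> (forall i, `|x 0 i - y 0 i| <= d) -> Omega x.
Proof.
move=> cK oO KO.
have := (compact_near_coveringP K).1 cK R (0^'+) (fun d y => ball y d `<=` Omega).
case.
- move=> y /KO Oy; have /nbhs_ballP[r /= r0 rO] : nbhs y Omega by exact: open_nbhs_nbhs.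
  exists (ball y (r / 2), [set d | 0 < d < r / 2]) => /=.
    split; first by apply: nbhsx_ballx; rewrite divr_gt0.
    near=> d; apply/andP; split; near: d; first exact: nbhs_right_gt.
    by apply: nbhs_right_lt; rewrite divr_gt0.
  move=> [z d] /= [yz /andP[d0 dr]] x zx; apply: rO.
  rewrite [r]splitr; apply: ball_triangle yz _.
  by apply: le_ball zx; exact: ltW.
move=> d /= d0 dP; exists (d / 2 / 2); first by rewrite !divr_gt0.
move=> x y Ky xy; have /= := dP (d / 2).
rewrite sub0r normrN gtr0_norm ?divr_gt0// => /(_ _ _ y Ky).
apply; first by rewrite ltr_pdivrMr// ltr_pMr// ltr1n.
  by [].
split; first by rewrite divr_gt0.
move=> i j; rewrite (ord1 i) /ball/= distrC (le_lt_trans (xy j))//.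
by rewrite ltr_pdivrMr ?ltr_pMr ?divr_gt0// ltr1n.
Unshelve. all: by end_near. Qed.

Variable n : nat.
Variable Omega : set 'rV[R]_n.
Hypothesis oO : open Omega.

(** Spelled as the integrand in [integral_on], so that [integral_on Omega f] is
    [integral_Rn (ext Omega f)] by conversion. *)
Definition ext (f : 'rV[R]_n -> R) : 'rV[R]_n -> R :=
  fun x => if `[< Omega x >] then f x else 0.

Lemma ext_in f x : Omega x -> ext f x = f x.
Proof. by move=> Ox; rewrite /ext asboolT. Qed.

Lemma ext_out f x : ~ Omega x -> ext f x = 0.
Proof. by move=> Ox; rewrite /ext asboolF. Qed.

Lemma near_ext_in f x : Omega x -> \forall y \near x, ext f y = f y.
Proof.
move=> Ox; have : nbhs x Omega by exact: open_nbhs_nbhs.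
by apply: filterS => y; exact: ext_in.
Qed.

Variable K : set 'rV[R]_n.
Hypothesis cK : compact K.

Lemma near_ext_out f x : (forall y, Omega y -> ~ K y -> f y = 0) -> ~ K x ->
  \forall y \near x, ext f y = 0.
Proof.
move=> f0 nKx; have clK : closed K by apply: compact_closed => //; exact: norm_hausdorff.
have : nbhs x (~` K) by apply: open_nbhs_nbhs; split=> //; exact: closed_openC.
apply: filterS => y nKy; rewrite /ext; case: asboolP => // Oy; exact: f0.
Qed.

Hypothesis KO : K `<=` Omega.
Variable L : nat.
Hypothesis KL : forall x, K x -> forall i, `|x 0 i| < L%:R.

(** [Omega] and the complement of [K] are open and cover the space. The extension agrees near each
    point with [f] in the first case and with zero in the second, so no regularity at the boundary
    of [Omega] enters. *)
Lemma cont_supp_ext f : (forall x, Omega x -> {for x, continuous f}) ->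
  (forall x, Omega x -> ~ K x -> f x = 0) -> cont_supp L (ext f).
Proof.
move=> cf f0; split=> [x|x i Lx]; last first.
  rewrite /ext; case: asboolP => // Ox; apply: f0 => // Kx.
  by have := KL Kx i; rewrite ltNge Lx.
have [Ox|nOx] := pselect (Omega x).
  have E := near_ext_in f Ox.
  apply: near_eq_continuous (cf x Ox).
  by apply: filterS E => y ->.
have nKx : ~ K x by move=> /KO.
have E := near_ext_out f0 nKx.
apply: (@near_eq_continuous _ _ (fun=> 0)); last exact: cst_continuous.
by apply: filterS E => y ->.
Qed.

Lemma C1_ext f (f' : 'I_n -> 'rV[R]_n -> R) :
  (forall x, Omega x -> {for x, continuous f}) ->
  (forall x, Omega x -> ~ K x -> f x = 0) ->
  (forall i x, Omega x -> is_derive x (evec R i) f (f' i x)) ->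
  (forall i x, Omega x -> {for x, continuous (f' i)}) ->
  C1_supp L (ext f) /\ forall i, pderiv i (ext f) = ext (f' i).
Proof.
move=> cf f0 df cf'.
have nO x : ~ Omega x -> ~ K x by move=> nOx /KO.
have D0 i x : ~ K x -> is_derive x (evec R i) (ext f) 0.
  move=> nKx; apply: (@near_eq_is_derive _ _ _ (fun=> 0)).
    by have E := near_ext_out f0 nKx; apply: filterS E => y ->.
have D1 i x : Omega x -> is_derive x (evec R i) (ext f) (f' i x).
  move=> Ox; apply: (@near_eq_is_derive _ _ _ f); last exact: df.
  by have E := near_ext_in f Ox; apply: filterS E => y ->.
(* On [Omega] minus [K] both descriptions of the extension hold, and uniqueness of the derivative
   forces [f'] to vanish. *)
have f'0 i x : Omega x -> ~ K x -> f' i x = 0.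
  move=> Ox nKx; have [_ <-] := D1 i x Ox; by have [_ ->] := D0 i x nKx.
have D i x : is_derive x (evec R i) (ext f) (ext (f' i) x).
  have [Ox|nOx] := pselect (Omega x); first by rewrite ext_in//; exact: D1.
  by rewrite ext_out//; apply: D0; exact: nO.
have E i : pderiv i (ext f) = ext (f' i).
  by apply/funext => x; rewrite /pderiv; have [] := D i x.
split=> //; split; first exact: cont_supp_ext.
move=> i; split; first by move=> x; apply: ex_derive.
rewrite E; apply: cont_supp_ext; [exact: cf'|exact: f'0].
Qed.

End Ext.

(** * Real inequalities *)

Section Real.
Variable R : realType.

(** Away from the origin [|t|^p = (t^2)^(p/2)] and the chain rule applies; at the origin
    [|t|^p <= t^2] for small [t], since [p > 2]. *)
Lemma is_derive_norm_powR (p : R) : 2 < p -> forall t : R,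
  is_derive t 1 (fun t : R => `|t| `^ p) (p * (`|t| `^ (p - 2) * t)).
Proof.
move=> p2 t; have p0 : 0 < p by lra.
have [->|t0] := eqVneq t 0.
  rewrite mulr0 mulr0; apply: (is_derive_quadratic (K := 1)); near=> x.
  rewrite normr0 powR0 ?gt_eqF// subr0 subr0 mul1r ger0_norm ?powR_ge0//.
  have [->|x0] := eqVneq x 0; first by rewrite normr0 powR0 ?gt_eqF// sqr_ge0.
  rewrite -real_normK ?num_real// -powR_mulrn//; apply: ger_powR; last exact: ltW.
  rewrite normr_gt0 x0 /=; near: x.
  by apply: (@nbhs0_le R R 1).
pose q := p / 2.
have nt (s : R) : `|s| `^ p = (s * s) `^ q.
  rewrite -expr2 -real_normK ?num_real// -powR_mulrn// -powRrM.
  by congr (_ `^ _); rewrite /q; field.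
rewrite (_ : (fun t : R => _) = fun s : R => (s * s) `^ q); last exact/funext.
have tt : 0 < t * t by rewrite -expr2 exprn_even_gt0.
have d2 : is_derive t 1 (fun s : R => s * s) (t * 2).
  by have H := derM (is_derive_id t 1) (is_derive_id t 1); apply: der_eq H _; ring.
have H := @der_comp _ _ _ _ _ (fun s : R => s * s) _ _ (is_derive1_powR q tt) d2.
apply: der_eq H _.
have -> : (t * t) `^ (q - 1) = `|t| `^ (p - 2).
  rewrite -expr2 -real_normK ?num_real// -powR_mulrn// -powRrM.
  by congr (_ `^ _); rewrite /q; field.
by rewrite /q; field.
Unshelve. all: by end_near. Qed.

Lemma sqrt_sum_lip n (f g : 'I_n -> R) :
  `|Num.sqrt (\sum_i f i ^+ 2) - Num.sqrt (\sum_i g i ^+ 2)| <= \sum_i `|f i - g i|.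
Proof.
have H (a b : 'I_n -> R) : Num.sqrt (\sum_i a i ^+ 2) <=
    Num.sqrt (\sum_i b i ^+ 2) + \sum_i `|a i - b i|.
  set B := Num.sqrt (\sum_i b i ^+ 2); set c := \sum_i `|_|.
  have B0 : 0 <= B by rewrite sqrtr_ge0.
  have c0 : 0 <= c by rewrite sumr_ge0.
  have BE : B ^+ 2 = \sum_i b i ^+ 2.
    by rewrite sqr_sqrtr// sumr_ge0// => i _; rewrite sqr_ge0.
  have bB i : `|b i| <= B.
    rewrite -sqrtr_sqr ler_wsqrtr// (bigD1 i)//= lerDl sumr_ge0// => j _.
    exact: sqr_ge0.
  have dc i : `|a i - b i| <= c by rewrite /c (bigD1 i)//= lerDl sumr_ge0.
  rewrite -[leRHS]ger0_norm ?addr_ge0// -sqrtr_sqr ler_wsqrtr//.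
  (* Summation gives [B^2 + (2B + c) c = (B + c)^2]; only the bounds [|b i| <= B] and
     [|a i - b i| <= c] are used. *)
  apply: le_trans (_ : \sum_i (b i ^+ 2 + (2 * B + c) * `|a i - b i|) <= _).
    apply: ler_sum => i _.
    have H1 : b i * (a i - b i) <= B * `|a i - b i|.
      by rewrite (le_trans (ler_norm _))// normrM ler_wpM2r.
    have H2 : (a i - b i) ^+ 2 <= c * `|a i - b i|.
      by rewrite -real_normK ?num_real// expr2 ler_wpM2r.
    by nra.
  rewrite big_split /= -mulr_sumr -BE -/c le_eqVlt; apply/orP; left; apply/eqP; ring.
have E : \sum_i `|g i - f i| = \sum_i `|f i - g i|.
  by apply: eq_bigr => i _; rewrite distrC.
have := H f g; have := H g f; rewrite E => H1 H2.
by rewrite ler_norml; apply/andP; split; lra.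
Qed.

Lemma le_sqrt_sum n (a : 'I_n -> R) i : `|a i| <= Num.sqrt (\sum_i a i ^+ 2).
Proof.
rewrite -sqrtr_sqr ler_wsqrtr// (bigD1 i)//= lerDl sumr_ge0// => j _.
exact: sqr_ge0.
Qed.

(** Squaring the first bound and inserting [X^2 <= A E] gives [A^(2n-2) <= (k^2 A E)^n]; dividing by
    [A^n] leaves [A^(n-2) <= (k^2 E)^n], and [2/p = (n-2)/n]. The division makes [A = 0] a separate
    case. *)
Lemma sobolev_algebra (n : nat) (A E X k : R) : (2 < n)%N ->
  0 <= A -> 0 <= X -> 0 <= E -> 0 < k ->
  A ^+ n.-1 <= (k * X) ^+ n ->
  (forall t, 0 < t -> 2 * X <= t * A + E / t) ->
  k ^- 2 * A `^ (2 / (2 * n%:R / (n%:R - 2))) <= E.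
Proof.
move=> n2 A0 X0 E0 k0 GN CS.
have nR : 2 < n%:R :> R by rewrite ltr_nat.
have -> : 2 / (2 * n%:R / (n%:R - 2)) = (n%:R - 2) / n%:R :> R.
  by field; apply/andP; split; lra.
have e0 : 0 < (n%:R - 2) / n%:R :> R by rewrite divr_gt0; lra.
move: A0; rewrite le_eqVlt => /predU1P[<-|A0]; first by rewrite powR0 ?mulr0// gt_eqF.
have XAE : X ^+ 2 <= A * E.
  move: X0; rewrite le_eqVlt => /predU1P[<-|X0].
    by rewrite expr0n mulr_ge0// ltW.
  (* The optimal parameter up to Cauchy-Schwarz is [t = X/A], for which [t * A = X] absorbs half of
     the left side. *)
  have := CS _ (divr_gt0 X0 A0); rewrite divfK ?gt_eqF// invf_div => H.
  have {}H : X <= E * (A / X) by lra.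
  by rewrite expr2 -ler_pdivlMr// (le_trans H)// mulrA [E * A]mulrC.
have H1 : A ^+ n.-2 <= (k ^+ 2 * E) ^+ n.
  have nE : n = n.-2.+2 by case: (n) n2 => [|[|]].
  have : (A ^+ n.-1) ^+ 2 <= ((k * X) ^+ n) ^+ 2 by rewrite lerXn2r ?nnegrE ?exprn_ge0// ?mulr_ge0// ltW.
  rewrite -[((k * X) ^+ n) ^+ 2]exprAC [(k * X) ^+ 2]exprMn => H.
  have {H} : (A ^+ n.-1) ^+ 2 <= (k ^+ 2 * (A * E)) ^+ n.
    apply: le_trans H _; rewrite lerXn2r ?nnegrE ?mulr_ge0 ?exprn_ge0 ?(ltW k0) ?(ltW A0)//.
    by rewrite ler_wpM2l// exprn_ge0// ltW.
  rewrite mulrCA exprMn -exprM.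
  have -> : (n.-1 * 2 = n + n.-2)%N 
    by case: (n) n2 => [|[|m]]//= _; rewrite muln2 doubleS -addnn.
  by rewrite exprD ler_pM2l// exprn_gt0.
have kE : 0 <= k ^+ 2 * E by rewrite mulr_ge0// exprn_ge0// ltW.
rewrite -ler_pdivlMl ?invr_gt0 ?exprn_gt0// invrK.
have -> : n%:R - 2 = n.-2%:R :> R.
  by case: (n) n2 => [|[|m]]//= _; rewrite -addn2 natrD addrK.
rewrite powRrM powR_mulrn ?(ltW A0)//.
have -> : k ^+ 2 * E = ((k ^+ 2 * E) ^+ n) `^ n%:R^-1.
  by rewrite -[(k ^+ 2 * E) ^+ n]powR_mulrn// -powRrM mulfV ?powRr1// gt_eqF//; lra.
rewrite ge0_ler_powR ?nnegrE ?exprn_ge0 ?(ltW A0)//.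
Qed.

End Real.

(** * The weighted inequality for C^1 functions *)

Section Continuity.
Variables (R : realType) (T : topologicalType).
Implicit Types (f g : T -> R) (x : T).

Lemma contD x f g : {for x, continuous f} -> {for x, continuous g} ->
  {for x, continuous (fun y => f y + g y)}.
Proof. by move=> cf cg; exact: continuousD. Qed.

Lemma contB x f g : {for x, continuous f} -> {for x, continuous g} ->
  {for x, continuous (fun y => f y - g y)}.
Proof. by move=> cf cg; exact: continuousB. Qed.

Lemma contM x f g : {for x, continuous f} -> {for x, continuous g} ->
  {for x, continuous (fun y => f y * g y)}.
Proof. by move=> cf cg; exact: continuousM. Qed.

Lemma contV x f : f x != 0 -> {for x, continuous f} ->
  {for x, continuous (fun y => (f y)^-1)}.
Proof. by move=> f0 cf; exact: continuousV. Qed.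

Lemma contZ x f a : {for x, continuous f} -> {for x, continuous (fun y => a * f y)}.
Proof. by move=> cf; apply: contM => //; exact: cst_continuous. Qed.

Lemma contX x f k : {for x, continuous f} -> {for x, continuous (fun y => f y ^+ k)}.
Proof.
move=> cf; apply: (@continuous_comp _ _ _ f (fun t => t ^+ k)) => //.
exact: exprn_continuous.
Qed.

Lemma cont_comp x f (h : R -> R) : {for x, continuous f} -> {for (f x), continuous h} ->
  {for x, continuous (fun y => h (f y))}.
Proof. by move=> cf ch; exact: continuous_comp. Qed.

Lemma cont_sum x (I : Type) (s : seq I) (F : I -> T -> R) :
  (forall i, {for x, continuous (F i)}) ->
  {for x, continuous (fun y => \sum_(i <- s) F i y)}.
Proof.
move=> cF; elim: s => [|i s IH].
  rewrite (_ : (fun _ => _) = fun=> 0); first exact: cst_continuous.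
  by apply/funext => y; rewrite big_nil.
rewrite (_ : (fun _ => _) = fun y => F i y + \sum_(j <- s) F j y).
  exact: contD.
by apply/funext => y; rewrite big_cons.
Qed.

Lemma cont_sqrt_sum x n (F : 'I_n -> T -> R) : (forall i, {for x, continuous (F i)}) ->
  {for x, continuous (fun y => Num.sqrt (\sum_i F i y ^+ 2))}.
Proof.
move=> cF; apply: cont_comp; last exact: sqrt_continuous.
by apply: cont_sum => i; apply: contX.
Qed.

Lemma cont_powR x f p : 0 < f x -> {for x, continuous f} ->
  {for x, continuous (fun y => f y `^ p)}.
Proof.
move=> f0 cf; apply: (@cont_comp _ _ (@powR R ^~ p)) => //.
exact: is_derive_continuous (is_derive1_powR p f0).
Qed.

End Continuity.

Section Weighted.
Variables (R : realType) (n : nat) (Omega : set 'rV[R]_n).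
Hypothesis oO : open Omega.

Lemma compact_sub_bounded (K : set 'rV[R]_n) (w : 'rV[R]_n -> R) : compact K ->
  K `<=` Omega -> (forall x, Omega x -> {for x, continuous w}) ->
  exists2 M : R, 0 < M & forall x, K x -> `|w x| <= M.
Proof.
move=> cK KO cw.
have cwK : {within K, continuous w}.
  apply: continuous_in_subspaceT => x; rewrite inE => /KO; exact: cw.
have /compact_bounded[M [Mr HM]] := continuous_compact cwK cK.
exists (`|M| + 1); first by rewrite ltr_wpDl.
move=> x Kx; apply: HM; last by exists x.
by rewrite (le_lt_trans (ler_norm _))// ltrDl.
Qed.

Lemma Cinf_c_is_derive (v : 'rV[R]_n -> R) i x : Cinf_c Omega v ->
  is_derive x (evec R i) v (pderiv i v x).
Proof. by move=> [/(_ 1%N)[H _] _ _]; apply: derivableP; exact: (H [::]). Qed.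

Lemma Cinf_c_continuous (v : 'rV[R]_n -> R) : Cinf_c Omega v ->
  continuous v /\ forall i, continuous (pderiv i v).
Proof.
move=> [/(_ 1%N)[_ H] _ _]; split=> [|i] x; first exact: (H [::]).
exact: (H [:: i]).
Qed.

Lemma pderiv_out (v : 'rV[R]_n -> R) i x :
  ~ closure [set x | v x != 0] x -> pderiv i v x = 0.
Proof.
move=> nx; have E : \forall y \near x, 0 = v y.
  have : nbhs x (~` closure [set x | v x != 0]).
    by apply: open_nbhs_nbhs; split=> //; apply: closed_openC; exact: closed_closure.
  apply: filterS => y ny; apply/eqP; rewrite eq_sym; apply: contra_notT ny => vy.
  exact: subset_closure.
have [_ <-] := near_eq_is_derive E (@is_derive_cst R _ R 0 x (evec R i)).
by [].
Qed.

Lemma out_closure (v : 'rV[R]_n -> R) x : ~ closure [set x | v x != 0] x -> v x = 0.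
Proof.
by move=> nx; apply/eqP; apply: contra_notT nx => vx; exact: subset_closure.
Qed.

Variables w1 w2 : 'rV[R]_n -> R.
Hypothesis cw1 : forall x, Omega x -> {for x, continuous w1}.
Hypothesis cw2 : forall x, Omega x -> {for x, continuous w2}.

(* A smooth function close to [g] in C^1 is supported near the support of [g],
   hence in a fixed compact subset of [Omega] where the weights are bounded. *)
Lemma weighted_C1 (C : R) (K : set 'rV[R]_n) (L : nat) (g : 'rV[R]_n -> R) :
  (forall v, Cinf_c Omega v ->
    C * integral_on Omega (fun x => w2 x * `|v x|) <=
    integral_on Omega (fun x => w1 x * grad_norm v x)) ->
  0 < C ->
  compact K -> K `<=` Omega -> (forall x, g x != 0 -> K x) -> C1_supp L g ->
  C * integral_on Omega (fun x => w2 x * `|g x|) <=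
  integral_on Omega (fun x => w1 x * grad_norm g x).
Proof.
move=> ineq C0 cK KO gK Cg.
have [d d0 dP] := compact_margin cK oO KO.
pose K0 := [set x : 'rV[R]_n | exists2 y : 'rV[R]_n, K y & forall i, `|x 0 i - y 0 i| <= d / 2].
have KK0 : K `<=` K0.
  by move=> x Kx; exists x => // i; rewrite subrr normr0 divr_ge0// ltW.
have clK0 x : closure K0 x -> exists2 y : 'rV[R]_n, K y & forall i, `|x 0 i - y 0 i| <= d.
  move=> K0x; have d2 : 0 < d / 2 by rewrite divr_gt0.
  have [z [[y Ky zy] xz]] := K0x _ (nbhsx_ballx x _ d2).
  exists y => // i; rewrite -(subrKA (z 0 i)).
  rewrite (le_trans (ler_normD _ _))// [leRHS]splitr lerD//.
  by apply: ltW; have [_] := xz; exact.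
have [l l0 Kl] := compact_box cK.
have cK1 : compact (closure K0).
  apply: bounded_closed_compact; last exact: closed_closure.
  exists (l%:R + d); split; first exact: num_real.
  move=> M lM x /clK0[y Ky xy] /=; rewrite [leLHS]/Num.norm /= mx_normrE.
  have M0 : 0 <= M by rewrite (le_trans _ (ltW lM))// addr_ge0// ltW.
  apply/bigmax_leP; split=> // -[j i] _ /=; rewrite (ord1 j).
  rewrite -[x 0 i](subrK (y 0 i)) (le_trans (ler_normD _ _))//.
  by rewrite addrC (le_trans _ (ltW lM))// lerD// ltW// Kl.
have K1O : closure K0 `<=` Omega by move=> x /clK0[y Ky xy]; exact: dP xy.
have [P P0 K1P] := compact_box cK1.
have [M1 M10 HM1] := compact_sub_bounded cK1 K1O cw1.
have [M2 M20 HM2] := compact_sub_bounded cK1 K1O cw2.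
have cs (w f : 'rV[R]_n -> R) : (forall x, Omega x -> {for x, continuous w}) ->
    continuous f -> (forall x, ~ closure K0 x -> f x = 0) ->
    cont_supp P (ext Omega (fun x => w x * f x)).
  move=> cw cf f0; apply: (cont_supp_ext oO cK1 K1O K1P) => [x Ox|x Ox nKx].
    by apply: contM; [exact: cw|exact: cf].
  by rewrite f0// mulr0.
have g0 x : ~ closure K0 x -> g x = 0.
  move=> nx; apply/eqP; apply: contra_notT nx => gx.
  by apply: subset_closure; apply: KK0; exact: gK.
have dg0 x i : ~ closure K0 x -> pderiv i g x = 0.
  move=> nx; apply: pderiv_out; apply: contra_not nx; apply: closureS => y gy.
  by apply: KK0; exact: gK.
have cgrad (f : 'rV[R]_n -> R) : (forall i, continuous (pderiv i f)) -> continuous (grad_norm f).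
  by move=> cf x; apply: cont_sqrt_sum => i; exact: cf.
have grad0 (f : 'rV[R]_n -> R) x : (forall i, pderiv i f x = 0) -> grad_norm f x = 0.
  by move=> f0; rewrite /grad_norm big1 ?sqrtr0// => i _; rewrite f0 expr0n.
pose S : R := (P.*2)%:R ^+ n.
have S0 : 0 <= S by rewrite exprn_ge0.
have Cg2 : cont_supp P (ext Omega (fun x => w2 x * `|g x|)).
  apply: cs => // [x|x /g0 ->]; last by rewrite normr0.
  by apply: cont_comp; [exact: Cg.1.1|exact: norm_continuous].
have Cg1 : cont_supp P (ext Omega (fun x => w1 x * grad_norm g x)).
  apply: cs => // [|x nx]; first by apply: cgrad => i; exact: (Cg.2 i).2.1.
  by apply: grad0 => i; exact: dg0.
(* The error is linear in [e], and its coefficient involves only the bounds of the weights on the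
   fixed compact set, the box [P] and [n], not the approximating function; hence [e] can be sent to
   zero. *)
suff approx e : 0 < e -> e <= d / 2 ->
    C * integral_on Omega (fun x => w2 x * `|g x|) <=
    integral_on Omega (fun x => w1 x * grad_norm g x) + (C * M2 * S + M1 * n%:R * S) * e.
  set B := C * M2 * S + M1 * n%:R * S.
  have B0 : 0 <= B by rewrite addr_ge0 ?mulr_ge0// ltW.
  apply/ler_addgt0Pr => e e0.
  pose e' := Num.min (d / 2) (e / (B + 1)).
  have B1 : 0 < B + 1 by rewrite ltr_wpDl.
  have e'0 : 0 < e' by rewrite lt_min !divr_gt0.
  apply: le_trans (approx _ e'0 _) _; first by rewrite /e' ge_min lexx.
  rewrite lerD2l (@le_trans _ _ (B * (e / (B + 1))))//.
    by rewrite ler_wpM2l// /e' ge_min lexx orbT.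
  by rewrite mulrCA ler_piMr ?(ltW e0)// ler_pdivrMr// mul1r lerDl.
move=> e0 ed.
have [psi [Cpsi psig dpsig psiK]] := smooth_approx Cg e0.
have psi0 : [set x | psi x != 0] `<=` K0.
  move=> x /psiK[y gy xy]; exists y; first exact: gK.
  by move=> i; rewrite (le_trans (xy i)).
have Cpc : Cinf_c Omega psi.
  split=> //.
    apply: subclosed_compact cK1 _; first exact: closed_closure.
    exact: closureS.
  by apply: subset_trans K1O; exact: closureS.
have [cpsi cdpsi] := Cinf_c_continuous Cpc.
have p0 x : ~ closure K0 x -> psi x = 0.
  by move=> nx; apply: out_closure; apply: contra_not nx; exact: closureS.
have dp0 x i : ~ closure K0 x -> pderiv i psi x = 0.
  by move=> nx; apply: pderiv_out; apply: contra_not nx; exact: closureS.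
have Cp2 : cont_supp P (ext Omega (fun x => w2 x * `|psi x|)).
  apply: cs => // [x|x /p0 ->]; last by rewrite normr0.
  by apply: cont_comp; [exact: cpsi|exact: norm_continuous].
have Cp1 : cont_supp P (ext Omega (fun x => w1 x * grad_norm psi x)).
  apply: cs => // [|x nx]; first exact: cgrad.
  by apply: grad0 => i; exact: dp0.
have bound (w f1 f2 : 'rV[R]_n -> R) (M c : R) : (forall x, closure K0 x -> `|w x| <= M) ->
    (forall x, ~ closure K0 x -> f1 x = 0) -> (forall x, ~ closure K0 x -> f2 x = 0) ->
    0 <= M -> 0 <= c -> (forall x, `|f1 x - f2 x| <= c) ->
    forall x, `|ext Omega (fun x => w x * f1 x) x - ext Omega (fun x => w x * f2 x) x| <= M * c.
  move=> wM f10 f20 M0 c0 f12 x.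
  have [Kx|nKx] := pselect (closure K0 x).
    have Ox := K1O _ Kx.
    by rewrite !ext_in// -mulrBr normrM ler_pM// wM.
  have E1 := f10 _ nKx; have E2 := f20 _ nKx.
  by rewrite /ext; case: asboolP => _; rewrite ?E1 ?E2 ?mulr0 subrr normr0 mulr_ge0.
have A2 : `|integral_on Omega (fun x => w2 x * `|psi x|) -
    integral_on Omega (fun x => w2 x * `|g x|)| <= M2 * e * S.
  apply: (integral_Rn_close Cp2 Cg2); apply: bound => // [x /p0 ->|x /g0 ->|||x].
  - by rewrite normr0.
  - by rewrite normr0.
  - exact: ltW.
  - exact: ltW.
  - exact: le_trans (ler_dist_dist _ _) _.
have A1 : `|integral_on Omega (fun x => w1 x * grad_norm psi x) -
    integral_on Omega (fun x => w1 x * grad_norm g x)| <= M1 * (n%:R * e) * S.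
  apply: (integral_Rn_close Cp1 Cg1); apply: bound => // [x nx|x nx|||x].
  - by apply: grad0 => i; exact: dp0.
  - by apply: grad0 => i; exact: dg0.
  - exact: ltW.
  - by rewrite mulr_ge0// ltW.
  - apply: le_trans (sqrt_sum_lip _ _) _.
    rewrite mulr_natl -[X in _ *+ X]card_ord -sumr_const.
    by apply: ler_sum => i _.
have := ineq psi Cpc.
move: A1 A2; rewrite !ler_distl => /andP[_ a1] /andP[a2 _] H.
have a2' := ler_wpM2l (ltW C0) a2.
have := le_trans (le_trans a2' H) a1.
rewrite mulrBr lerBlDr => /le_trans; apply.
by rewrite le_eqVlt; apply/orP; left; apply/eqP; ring.
Qed.

End Weighted.

(** * The ground state substitution *)

Section GroundState.
Variables (R : realType) (n : nat) (Omega : set 'rV[R]_n) (phi u : 'rV[R]_n -> R).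
Hypothesis n3 : (3 <= n)%N.
Hypothesis oO : open Omega.
Hypothesis Cphi : Ck_on 2 Omega phi.
Hypothesis phi0 : forall x, Omega x -> 0 < phi x.
Hypothesis Cu : Cinf_c Omega u.

Let K := closure [set x | u x != 0].
Let cK : compact K. Proof. by have [_ + _] := Cu. Qed.
Let KO : K `<=` Omega. Proof. by have [_ _] := Cu. Qed.

Variable L : nat.
Hypothesis L0 : (0 < L)%N.
Hypothesis KL : forall x, K x -> forall i, `|x 0 i| < L%:R.

Variable a : R.
Hypothesis aE : a = 2 * (n%:R - 1) / (n%:R - 2).

Let nR : 3 <= n%:R :> R. Proof. by rewrite ler_nat. Qed.

Let n2 : n%:R - 2 != 0 :> R. Proof. by rewrite gt_eqF//; have := nR; move=> ?; lra. Qed.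

Let a2 : 2 < a.
Proof. by have nR' := nR; rewrite aE ltr_pdivlMr; lra. Qed.

Let dphi i x : Omega x -> is_derive x (evec R i) phi (pderiv i phi x).
Proof. by move=> Ox; apply: derivableP; exact: (Cphi.1 [::]). Qed.

Let ddphi i j x : Omega x ->
  is_derive x (evec R j) (pderiv i phi) (pderiv j (pderiv i phi) x).
Proof. by move=> Ox; apply: derivableP; exact: (Cphi.1 [:: i]). Qed.

Let cphi x : Omega x -> {for x, continuous phi}.
Proof. by move=> Ox; exact: (Cphi.2 [::]). Qed.

Let cdphi i x : Omega x -> {for x, continuous (pderiv i phi)}.
Proof. by move=> Ox; exact: (Cphi.2 [:: i]). Qed.

Let cddphi i j x : Omega x -> {for x, continuous (pderiv j (pderiv i phi))}.
Proof. by move=> Ox; exact: (Cphi.2 [:: j; i]). Qed.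

Let cu x : {for x, continuous u}. Proof. exact: (Cinf_c_continuous Cu).1. Qed.

Let cdu i x : {for x, continuous (pderiv i u)}.
Proof. exact: (Cinf_c_continuous Cu).2. Qed.

Let du i x : is_derive x (evec R i) u (pderiv i u x).
Proof. exact: Cinf_c_is_derive Cu. Qed.

Let phiN0 x : Omega x -> phi x != 0. Proof. by move=> /phi0/gt_eqF ->. Qed.

Let u0 x : ~ K x -> u x = 0. Proof. exact: out_closure. Qed.

Let du0 i x : ~ K x -> pderiv i u x = 0. Proof. exact: pderiv_out. Qed.

(** Continuity is asked inside [Omega] only, because [1/phi] need not extend to the boundary;
    vanishing off the support [K] of [u] makes the extension by zero continuous everywhere. *)
Definition admissible (f : 'rV[R]_n -> R) :=
  (forall x, Omega x -> {for x, continuous f}) /\ (forall x, Omega x -> ~ K x -> f x = 0).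

Let cs f : admissible f -> cont_supp L (ext Omega f).
Proof. by move=> [cf f0]; exact: (cont_supp_ext oO cK KO KL). Qed.

Let intD f g : admissible f -> admissible g ->
  integral_on Omega (fun x => f x + g x) = integral_on Omega f + integral_on Omega g.
Proof.
move=> af ag; rewrite -(integral_RnD L0 (cs af) (cs ag)); congr integral_Rn.
by apply/funext => x; rewrite /ext; case: asboolP => // _; rewrite addr0.
Qed.

Let intZ c f : admissible f -> integral_on Omega (fun x => c * f x) = c * integral_on Omega f.
Proof.
move=> af; rewrite -(integral_RnZ c L0 (cs af)); congr integral_Rn.
by apply/funext => x; rewrite /ext; case: asboolP => // _; rewrite mulr0.
Qed.

Let int_le f g : admissible f -> admissible g -> (forall x, Omega x -> f x <= g x) ->
  integral_on Omega f <= integral_on Omega g.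
Proof.
move=> af ag fg; apply: (le_integral_Rn L0 (cs af) (cs ag)) => x.
by rewrite /ext; case: asboolP => // Ox; exact: fg.
Qed.

Let int_eq f g : (forall x, Omega x -> f x = g x) -> integral_on Omega f = integral_on Omega g.
Proof.
move=> fg; congr integral_Rn; apply/funext => x.
by case: asboolP => // Ox; exact: fg.
Qed.

Let int_ge0 f : admissible f -> (forall x, 0 <= f x) -> 0 <= integral_on Omega f.
Proof.
move=> af f0; have <- : integral_on Omega (fun x => 0 * f x) = 0 by rewrite intZ// mul0r.
apply: int_le => // [|x _]; last by rewrite mul0r.
split=> x Ox; first by apply: contZ; exact: af.1.
by move=> nK; rewrite mul0r.
Qed.

(* [Z i] is [phi] times the [i]-th partial derivative of [u / phi]. *)
Let Z i x := pderiv i u x - u x * (pderiv i phi x / phi x).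
Let normZ x := Num.sqrt (\sum_i Z i x ^+ 2).

Let cZ i x : Omega x -> {for x, continuous (Z i)}.
Proof.
move=> Ox; apply: contB; first exact: cdu.
apply: contM; first exact: cu.
apply: contM; first exact: cdphi.
by apply: contV; [exact: phiN0|exact: cphi].
Qed.

Let cnormZ x : Omega x -> {for x, continuous normZ}.
Proof. by move=> Ox; apply: cont_sqrt_sum => i; exact: cZ. Qed.

Let normZ0 x : ~ K x -> normZ x = 0.
Proof.
move=> nK; rewrite /normZ big1 ?sqrtr0// => i _.
by rewrite /Z du0// u0// mul0r subrr expr0n.
Qed.

Let sqr_normZ x : normZ x ^+ 2 = \sum_i Z i x ^+ 2.
Proof. by rewrite sqr_sqrtr// sumr_ge0// => i _; exact: sqr_ge0. Qed.

Let adm_E : admissible (fun x => normZ x ^+ 2).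
Proof.
split=> x Ox; first by apply: contX; exact: cnormZ.
by move=> nK; rewrite normZ0// expr0n.
Qed.

Let cgrad (f : 'rV[R]_n -> R) x : (forall i, {for x, continuous (pderiv i f)}) ->
  {for x, continuous (grad_norm f)}.
Proof. by move=> cf; apply: cont_sqrt_sum. Qed.

Let cnormu p x : 0 < p -> {for x, continuous (fun y => `|u y| `^ p)}.
Proof.
move=> p0; apply: (@cont_comp _ _ _ u (fun t => `|t| `^ p)); first exact: cu.
exact: continuous_norm_powR.
Qed.

Let normu0 p x : 0 < p -> ~ K x -> `|u x| `^ p = 0.
Proof. by move=> p0 nK; rewrite u0// normr0 powR0// gt_eqF. Qed.

Let adm_A p : 0 < p -> admissible (fun x => `|u x| `^ p).
Proof. by move=> p0; split=> x Ox; [exact: cnormu|exact: normu0]. Qed.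

Let adm_X : admissible (fun x => `|u x| `^ (a - 1) * normZ x).
Proof.
split=> x Ox; last by move=> nK; rewrite normZ0// mulr0.
apply: contM; last exact: cnormZ.
by apply: cnormu; have := a2; move=> ?; lra.
Qed.

Let adm_Y : admissible (fun x => `|u x| `^ a * (grad_norm phi x / phi x)).
Proof.
have a0 : 0 < a by have := a2; move=> ?; lra.
split=> x Ox; last by move=> nK; rewrite normu0// mul0r.
apply: contM; first exact: cnormu.
apply: contM; first by apply: cgrad => i; exact: cdphi.
by apply: contV; [exact: phiN0|exact: cphi].
Qed.

Let E := integral_on Omega (fun x => normZ x ^+ 2).
Let A := integral_on Omega (fun x => `|u x| `^ (2 * n%:R / (n%:R - 2))).
Let X := integral_on Omega (fun x => `|u x| `^ (a - 1) * normZ x).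
Let Y := integral_on Omega (fun x => `|u x| `^ a * (grad_norm phi x / phi x)).

Lemma ground_state :
  integral_on Omega (fun x => grad_norm u x ^+ 2) +
  integral_on Omega (fun x => laplacian phi x / phi x * `|u x| ^+ 2) = E.
Proof.
(* The vector field [u^2 (grad phi)/phi]. Its off-diagonal derivatives are recorded as well, since
   [C1_supp] asks for every direction. *)
pose F i x := u x * u x * (pderiv i phi x / phi x).
pose F' i j x := (pderiv j u x * u x + u x * pderiv j u x) * (pderiv i phi x / phi x)
  + u x * u x * (pderiv j (pderiv i phi) x / phi x
                 + pderiv i phi x * (- pderiv j phi x / phi x ^+ 2)).
have cV x : Omega x -> {for x, continuous (fun y => (phi y)^-1)}.
  by move=> Ox; apply: contV; [exact: phiN0|exact: cphi].
have cq i x : Omega x -> {for x, continuous (fun y => pderiv i phi y / phi y)}.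
  by move=> Ox; apply: contM; [exact: cdphi|exact: cV].
have cuu x : {for x, continuous (fun y => u y * u y)} by apply: contM; exact: cu.
have cF' i j x : Omega x -> {for x, continuous (F' i j)}.
  move=> Ox; apply: contD; apply: contM => //.
  - by apply: contD; apply: contM; first [exact: cdu|exact: cu].
  - exact: cq.
  - apply: contD; apply: contM; [exact: cddphi|exact: cV|exact: cdphi|].
    have E2 : (fun y => - pderiv j phi y / phi y ^+ 2) =
        (fun y => -1 * (pderiv j phi y / phi y * (phi y)^-1)).
      by apply/funext => y; rewrite expr2 invfM; ring.
    by rewrite E2; apply: contZ; apply: contM; [exact: cq|exact: cV].
have aF' i : admissible (F' i i).
  by split=> x Ox; [exact: cF'|move=> nK; rewrite /F' u0// !(mul0r, mulr0, addr0)].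
have H i : C1_supp L (ext Omega (F i)) /\ forall j, pderiv j (ext Omega (F i)) = ext Omega (F' i j).
  apply: (C1_ext oO cK KO KL) => [x Ox|x Ox nK|j x Ox|j x Ox].
  - by apply: contM => //; exact: cq.
  - by rewrite /F u0// !mul0r.
  - apply: derM; first exact: derM.
    by apply: derM; [exact: ddphi|apply: derV; [exact: phiN0|exact: dphi]].
  - exact: cF'.
have aG : admissible (fun x => grad_norm u x ^+ 2).
  split=> x Ox; first by apply: contX; apply: cgrad => i; exact: cdu.
  by move=> nK; rewrite /grad_norm big1 ?sqrtr0 ?expr0n// => i _; rewrite du0// expr0n.
have aL : admissible (fun x => laplacian phi x / phi x * `|u x| ^+ 2).
  split=> x Ox; last by move=> nK; rewrite u0// normr0 expr0n mulr0.
  apply: contM; last by apply: contX; apply: cont_comp; [exact: cu|exact: norm_continuous].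
  by apply: contM; [apply: cont_sum => i; exact: cddphi|exact: cV].
have aS : admissible (fun x => \sum_i F' i i x).
  split=> x Ox; first by apply: cont_sum => i; exact: cF'.
  by move=> nK; rewrite big1// => i _; exact: (aF' i).2.
have S0 : integral_on Omega (fun x => \sum_i F' i i x) = 0.
  have -> : integral_on Omega (fun x => \sum_i F' i i x) =
      integral_Rn (fun x => \sum_i ext Omega (F' i i) x).
    congr integral_Rn; apply/funext => x; case: asboolP => Ox.
      by apply: eq_bigr => i _; rewrite ext_in.
    by rewrite big1// => i _; rewrite ext_out.
  rewrite (integral_Rn_sum _ L0 (fun i => cs (aF' i))).2 big1// => i _.
  by rewrite -(H i).2 (integral_pderiv0 _ L0 (H i).1).
(* The integral of the divergence is inserted as a zero; what remains is a pointwise identity,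
   verified coordinate by coordinate. *)
rewrite -intD// -[RHS]addr0 -S0 -intD//; apply: int_eq => x Ox.
rewrite sqr_sqrtr; last by rewrite sumr_ge0// => i _; exact: sqr_ge0.
rewrite sqr_normZ /laplacian real_normK ?num_real// !mulr_suml -!big_split /=.
apply: eq_bigr => i _; rewrite /Z /F'; field; exact: phiN0.
Qed.

(** The form with a parameter is linear in the integrals: it follows from a pointwise square being
    nonnegative, together with linearity and monotonicity. *)
Lemma cauchy_schwarz t : 0 < t -> 2 * X <= t * A + E / t.
Proof.
move=> t0; have q0 : 0 < 2 * n%:R / (n%:R - 2) :> R by rewrite divr_gt0; have := nR; move=> ?; lra.
rewrite [E / t]mulrC -intZ// -(intZ _ (adm_A q0)) -intZ//.
have aA := adm_A q0.
rewrite -intD; last 2 first.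
- split=> x Ox; first by apply: contZ; exact: aA.1.
  by move=> nK; rewrite normu0// mulr0.
- split=> x Ox; first by apply: contZ; exact: adm_E.1.
  by move=> nK; rewrite normZ0// expr0n mulr0.
apply: int_le.
- split=> x Ox; first by apply: contZ; exact: adm_X.1.
  by move=> nK; rewrite normZ0// !mulr0.
- split=> x Ox; last by move=> nK; rewrite normu0// normZ0// expr0n !mulr0 addr0.
  by apply: contD; apply: contZ; [exact: aA.1|exact: adm_E.1].
move=> x _; have -> : `|u x| `^ (2 * n%:R / (n%:R - 2)) = (`|u x| `^ (a - 1)) ^+ 2.
  rewrite -powR_mulrn ?powR_ge0// -powRrM; congr (_ `^ _).
  by rewrite aE; field.
set p := _ `^ _; set z := normZ x.
rewrite -subr_ge0 (_ : _ - _ = t^-1 * (t * p - z) ^+ 2); last by field; rewrite gt_eqF.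
by rewrite mulr_ge0 ?sqr_ge0// invr_ge0 ltW.
Qed.

Let d_pow i x : is_derive x (evec R i) (fun y => `|u y| `^ a)
  (a * (`|u x| `^ (a - 2) * u x) * pderiv i u x).
Proof.
exact: (@der_comp _ _ _ _ (fun t => `|t| `^ a) u _ _ (is_derive_norm_powR a2 (u x)) (du i x)).
Qed.

Let c_pow' x : {for x, continuous (fun y => a * (`|u y| `^ (a - 2) * u y))}.
Proof.
by apply: contZ; apply: contM; [apply: cnormu; have := a2; move=> ?; lra|exact: cu].
Qed.

Let powB1 (t : R) : 0 <= t -> t * t `^ (a - 2) = t `^ (a - 1).
Proof.
move=> t0; have := @mulr_powRB1 R t (a - 1) t0; rewrite (_ : a - 1 - 1 = a - 2); last by ring.
by apply; have := a2; move=> ?; lra.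
Qed.

Let powB2 (t : R) : `|t| `^ a = t ^+ 2 * `|t| `^ (a - 2).
Proof.
rewrite -real_normK ?num_real// expr2 -mulrA powB1// mulr_powRB1//.
by have := a2; move=> ?; lra.
Qed.

(** Every partial derivative of [|u|^a] is at most [a |u|^(a-1) (|Z| + |u| |grad phi|/phi)] in
    absolute value, so each of the [n] Gagliardo-Nirenberg factors is at most [a (X + Y)], and
    [Y <= (a/C) X]. *)
Lemma sobolev_step (C : R) : 0 < C -> C * Y <= a * X ->
  A ^+ n.-1 <= (a * (1 + a / C) * X) ^+ n.
Proof.
move=> C0 CY.
have a0 : 0 < a by have := a2; move=> ?; lra.
have [Cw dw] := @C1_ext R n Omega oO K cK KO L KL (fun y => `|u y| `^ a)
  (fun i x => a * (`|u x| `^ (a - 2) * u x) * pderiv i u x)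
  (fun x _ => cnormu a0) (fun x _ => normu0 a0) (fun i x _ => d_pow i x)
  (fun i x _ => contM (c_pow' (x := x)) (@cdu i x)).
have n1 : (1 < n)%N by exact: leq_trans n3.
have := gagliardo_nirenberg n1 L0 Cw.
have -> : integral_Rn (fun x => `|ext Omega (fun y => `|u y| `^ a) x| `^ (n%:R / (n%:R - 1))) = A.
  congr integral_Rn; apply/funext => x; rewrite /ext; case: asboolP => _.
    rewrite ger0_norm ?powR_ge0// -powRrM; congr (_ `^ _); rewrite aE; field.
    by apply/andP; split; rewrite gt_eqF//; have := nR; move=> ?; lra.
  by rewrite normr0 powR0// gt_eqF// divr_gt0; have := nR; move=> ?; lra.
move=> /le_trans; apply.
rewrite -[X in _ ^+ X]card_ord -prodr_const; apply: ler_prod => i _; apply/andP; split.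
  rewrite -[X in X <= _](@integral_Rn0 R n); apply: (@le_integral_Rn R n L) => //.
  - by split=> // x; exact: cst_continuous.
  - exact: cont_supp_norm (Cw.2 i).2.
rewrite dw.
have -> : integral_Rn (fun x => `|ext Omega (fun x => a * (`|u x| `^ (a - 2) * u x) * pderiv i u x) x|) =
    integral_on Omega (fun x => a * (`|u x| `^ (a - 1) * `|pderiv i u x|)).
  congr integral_Rn; apply/funext => x; rewrite /ext; case: asboolP => _; last by rewrite normr0.
  rewrite !normrM (gtr0_norm a0) (ger0_norm (powR_ge0 _ _)) -mulrA; congr (_ * (_ * _)).
  by rewrite mulrC powB1.
apply: (@le_trans _ _ (a * (X + Y))); last first.
  rewrite -mulrA ler_pM2l// mulrDl mul1r lerD2l.
  by rewrite mulrAC ler_pdivlMr// mulrC.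
rewrite -intD// -intZ; last first.
  split=> x Ox; first by apply: contD; [exact: adm_X.1|exact: adm_Y.1].
  by move=> nK; rewrite normZ0// mulr0 add0r adm_Y.2.
apply: int_le.
- split=> x Ox; last by move=> nK; rewrite du0// normr0 !mulr0.
  apply: contZ; apply: contM; first by apply: cnormu; have := a2; move=> ?; lra.
  by apply: cont_comp; [exact: cdu|exact: norm_continuous].
- split=> x Ox; first by apply: contZ; apply: contD; [exact: adm_X.1|exact: adm_Y.1].
  by move=> nK; rewrite normZ0// mulr0 add0r adm_Y.2// mulr0.
move=> x Ox; rewrite ler_pM2l//.
have -> : `|u x| `^ a = `|u x| `^ (a - 1) * `|u x| by rewrite mulrC mulr_powRB1.
rewrite -mulrA -mulrDr ler_wpM2l ?powR_ge0//.
rewrite -[pderiv i u x](subrK (u x * (pderiv i phi x / phi x))) (le_trans (ler_normD _ _))// lerD//.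
  exact: (le_sqrt_sum (fun i => Z i x)).
rewrite normrM ler_wpM2l// normrM normfV (gtr0_norm (phi0 Ox)).
by rewrite ler_wpM2r ?invr_ge0 ?(ltW (phi0 Ox))//; exact: (le_sqrt_sum (fun i => pderiv i phi x)).
Qed.

Lemma weighted_step (C : R) : 0 < C ->
  (forall v, Cinf_c Omega v ->
    C * integral_on Omega (fun x => phi x `^ (n%:R / (n%:R - 2)) * grad_norm phi x * `|v x|)
    <= integral_on Omega (fun x => phi x `^ a * grad_norm v x)) ->
  C * Y <= a * X.
Proof.
move=> C0 ineq.
have a0 : 0 < a by have := a2; move=> ?; lra.
pose g x := `|u x| `^ a * phi x `^ (- a).
pose g' i x := a * (`|u x| `^ (a - 2) * u x) * pderiv i u x * phi x `^ (- a)
  + `|u x| `^ a * (- a * phi x `^ (- a - 1) * pderiv i phi x).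
have [Cg dg] : C1_supp L (ext Omega g) /\ forall i, pderiv i (ext Omega g) = ext Omega (g' i).
  apply: (C1_ext oO cK KO KL) => [x Ox|x Ox nK|i x Ox|i x Ox].
  - by apply: contM; [exact: cnormu|apply: cont_powR; [exact: phi0|exact: cphi]].
  - by rewrite /g normu0// mul0r.
  - apply: derM; first exact: d_pow.
    by apply: (@der_comp _ _ _ _ (@powR R ^~ (- a))); [apply: is_derive1_powR; exact: phi0|exact: dphi].
  - have cp p : {for x, continuous (fun y => phi y `^ p)}.
      by apply: cont_powR; [exact: phi0|exact: cphi].
    apply: contD; apply: contM => //.
    + by apply: contM; [exact: c_pow'|exact: cdu].
    + exact: cnormu.
    + by apply: contM; [apply: contZ|exact: cdphi].
(* Writing [|u|^a = u^2 |u|^(a-2)] lets both terms of the product rule share the factor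
   [|u|^(a-2) u]; the bracket left over is [Z i]. *)
have g'E i x : Omega x -> g' i x = a * (`|u x| `^ (a - 2) * u x) * phi x `^ (- a) * Z i x.
  move=> Ox; rewrite /g' /Z powB2.
  have -> : phi x `^ (- a - 1) = phi x `^ (- a) / phi x.
    by rewrite powRB ?powRr1 ?phiN0 ?implybT// ltW// phi0.
  ring.
have w1c x : Omega x -> {for x, continuous (fun y => phi y `^ a)}.
  by move=> Ox; apply: cont_powR; [exact: phi0|exact: cphi].
have w2c x : Omega x -> {for x, continuous (fun y => phi y `^ (n%:R / (n%:R - 2)) * grad_norm phi y)}.
  move=> Ox; apply: contM; last by apply: cgrad => i; exact: cdphi.
  by apply: cont_powR; [exact: phi0|exact: cphi].
have gK x : ext Omega g x != 0 -> K x.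
  apply: contra_neqP => nK; rewrite /ext; case: asboolP => // _.
  by rewrite /g normu0// mul0r.
have := weighted_C1 oO w1c w2c ineq C0 cK KO gK Cg.
rewrite (@int_eq _ (fun x => `|u x| `^ a * (grad_norm phi x / phi x))); last first.
  move=> x Ox; rewrite ext_in// /g ger0_norm ?mulr_ge0 ?powR_ge0//.
  have -> : (phi x)^-1 = phi x `^ (n%:R / (n%:R - 2)) * phi x `^ (- a).
    rewrite -powRD ?phiN0 ?implybT// -powR_inv1 ?(ltW (phi0 Ox))//; congr (_ `^ _).
    by rewrite aE; field.
  ring.
rewrite -/Y (@int_eq _ (fun x => a * (`|u x| `^ (a - 1) * normZ x))) ?intZ//.
move=> x Ox; rewrite /grad_norm.
rewrite (eq_bigr (fun i => (a * (`|u x| `^ (a - 2) * u x) * phi x `^ (- a)) ^+ 2 * Z i x ^+ 2)); last first.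
  by move=> i _; rewrite dg ext_in// g'E// exprMn.
rewrite -mulr_sumr sqrtrM ?sqr_ge0// sqrtr_sqr -/(normZ x) !normrM.
rewrite (gtr0_norm a0) !(ger0_norm (powR_ge0 _ _)).
have -> : `|u x| `^ (a - 2) * `|u x| = `|u x| `^ (a - 1) by rewrite mulrC powB1.
have pp : phi x `^ a * phi x `^ (- a) = 1.
  by rewrite -powRD ?phiN0 ?implybT// subrr powRr0.
by rewrite -[RHS]mul1r -pp; ring.
Qed.

Lemma sobolev_remainder (C : R) : 0 < C ->
  (forall v, Cinf_c Omega v ->
    C * integral_on Omega (fun x => phi x `^ (n%:R / (n%:R - 2)) * grad_norm phi x * `|v x|)
    <= integral_on Omega (fun x => phi x `^ a * grad_norm v x)) ->
  (a * (1 + a / C)) ^- 2 * A `^ (2 / (2 * n%:R / (n%:R - 2))) <= E.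
Proof.
move=> C0 ineq; have a0 : 0 < a by have := a2; move=> ?; lra.
have q0 : 0 < 2 * n%:R / (n%:R - 2) :> R by rewrite divr_gt0; have := nR; move=> ?; lra.
apply: (@sobolev_algebra R n A E X) => //.
- by apply: (int_ge0 (adm_A q0)) => x; exact: powR_ge0.
- by apply: (int_ge0 adm_X) => x; rewrite mulr_ge0 ?powR_ge0 ?sqrtr_ge0.
- by apply: (int_ge0 adm_E) => x; exact: sqr_ge0.
- by rewrite mulr_gt0// addr_gt0// divr_gt0.
- by apply: sobolev_step => //; exact: weighted_step.
- exact: cauchy_schwarz.
Qed.

End GroundState.

Theorem theoremC (R : realType) (n : nat) (hn : (3 <= n)%N)
  (Omega : set 'rV[R]_n) (phi : 'rV[R]_n -> R) :
  smooth_domain Omega ->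
  Ck_on 2 Omega phi ->
  (forall x, Omega x -> 0 < phi x) ->
  (exists C : R, 0 < C /\
     forall v, Cinf_c Omega v ->
       integral_on Omega (fun x =>
           phi x `^ (2 * (n%:R - 1) / (n%:R - 2)) * grad_norm v x)
       >= C * integral_on Omega (fun x =>
           phi x `^ (n%:R / (n%:R - 2)) * grad_norm phi x * `|v x|)) ->
  exists c : R, 0 < c /\
    forall u, Cinf_c Omega u ->
      integral_on Omega (fun x => grad_norm u x ^+ 2)
      >= - integral_on Omega (fun x => laplacian phi x / phi x * `|u x| ^+ 2)
         + c * (integral_on Omega (fun x => `|u x| `^ (2 * n%:R / (n%:R - 2))))
               `^ (2 / (2 * n%:R / (n%:R - 2))).
Proof.
move=> [oO _ _ _] Cphi phi0 [C [C0 ineq]].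
pose a : R := 2 * (n%:R - 1) / (n%:R - 2).
have nR : 3 <= n%:R :> R by rewrite ler_nat.
have a0 : 0 < a by rewrite divr_gt0; lra.
(* This is [k^(-2)] with the Sobolev constant [k = a (1 + a/C)]. It depends on [n] and [C] alone;
   the box [L], which depends on [u], does not enter it. *)
exists ((a * (1 + a / C)) ^- 2); split.
  by rewrite invr_gt0 exprn_gt0// mulr_gt0// addr_gt0// divr_gt0.
move=> u Cu; have [_ cK _] := Cu; have [L L0 KL] := compact_box cK.
have GS := ground_state oO Cphi phi0 Cu L0 KL.
have SR := sobolev_remainder hn oO Cphi phi0 Cu L0 KL (erefl a) C0 ineq.
by rewrite addrC lerBlDr GS.
Qed.
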